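(* Let $H$ be a real Hilbert space, let $C$ be a nonempty closed convex subset of $H$, and let $f:H\to\mathbb R$ be a proper, closed convex function that is differentiable with an $L$-Lipschitz continuous gradient, $L>0$. Put $\beta=1/L$. Let $\Omega$ be the solution set of the constrained convex minimization problem $\min f(x)$ subject to $x\in C$, and assume $\Omega\ne\emptyset$. Let $\alpha>0$, $\{\eta_k\}_{k\in\mathbb N}\in\ell^1_+(\mathbb N)$ and $\{U_k\}_{k\in\mathbb N}\subset\mathcal P_\alpha(H)$ be such that $\mu:=\sup_{k\in\mathbb N}\|U_k\|<+\infty$ and $(1+\eta_k)U_{k+1}\succeq U_k$ for all $k\in\mathbb N$. Let $\gamma_k\in(0,\frac{2\beta}{\|U_k\|})$ and $\lambda_k\in(0,\frac1{\alpha_k})$, where $\alpha_k=\frac{2\beta}{4\beta-\gamma_k\|U_k\|}$, for all $k\in\mathbb N$. Let $\{a_k\},\{b_k\}$ be sequences in $H$ with $\sum_{k=0}^{+\infty}\lambda_k\|a_k\|<+\infty$ and $\sum_{k=0}^{+\infty}\lambda_k\|b_k\|<+\infty$. Assume moreover that at least one of the following two sets of conditions holds, where $\underline\lambda,\tau,\underline\gamma,\epsilon$ are constants and the inequalities hold for all $k$: (A) $0<\underline\lambda\le\lambda_k\le\frac1{\alpha_k}-\tau$ with $\tau\in(0,\frac1{\alpha_k}-\underline\lambda)$; and $0<\underline\gamma\le\gamma_k\le\frac{2\beta-\epsilon}{\mu}$ with $\epsilon\in(0,2\beta-\mu\underline\gamma)$. (B) $\sum_{k=0}^{+\infty}\lambda_k(\frac1{\alpha_k}-\lambda_k)=+\infty$;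 $0<\underline\gamma\le\gamma_k\le\frac{2\beta-\epsilon}{\mu}$ with $\epsilon\in(0,2\beta-\mu\underline\gamma)$; $\sum_{k=0}^{+\infty}|\gamma_{k+1}-\gamma_k|<+\infty$, $\sum_{k=0}^{+\infty}\big|\gamma_{k+1}\|U_{k+1}\|-\gamma_k\|U_k\|\big|<+\infty$, and $\sum_{k=0}^{+\infty}\|U_k^{-1}x-U_{k+1}^{-1}x\|<+\infty$ for any $x\in H$; and $\lambda_k\ge\underline\lambda>0$. Let $x_0\in H$ and, for $k\in\mathbb N$, set $$y_k=x_k-\gamma_kU_k(\nabla f(x_k)+b_k),\qquad x_{k+1}=x_k+\lambda_k\big(P_C^{U_k^{-1}}(y_k)+a_k-x_k\big).$$ Then the following hold: (i) For any $x^*\in\Omega$, $\lim_{k\to+\infty}\|x_k-x^*\|_{U_k^{-1}}$ exists; (ii) $\lim_{k\to+\infty}\|x_k-P_C^{U_k^{-1}}(x_k-\gamma_kU_k\nabla f(x_k))\|=0$; (iii) $\{x_k\}$ converges weakly to a point in $\Omega$; (iv) $\nabla f(x_k)\to\nabla f(x^* )$ strongly as $k\to+\infty$, where $x^*\in\Omega$.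
   Context: $\mathbb N$ is the set of nonnegative integers, and $\ell^1_+(\mathbb N)$ is the set of summable sequences in $[0,+\infty)$. For bounded self-adjoint linear operators $U,V$ on $H$, $U\succeq V$ means $\langle Ux,x\rangle\ge\langle Vx,x\rangle$ for all $x\in H$; $\mathcal P_\alpha(H)$ is the set of bounded self-adjoint linear operators $U$ on $H$ with $U\succeq\alpha I$. $\|U\|$ is the operator norm. For $U\in\mathcal P_\alpha(H)$ with $\alpha>0$, $\|x\|_{U^{-1}}=\sqrt{\langle U^{-1}x,x\rangle}$, and $P_C^{U^{-1}}(x)=\arg\min_{y\in C}\|x-y\|_{U^{-1}}$ is the projector onto $C$ relative to the norm $\|\cdot\|_{U^{-1}}$. *)

(* Defs.v *)
From HB Require Import structures.
From mathcomp Require Export all_boot all_order all_algebra.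
From mathcomp Require Export all_classical all_reals all_analysis.
Export Order.TTheory GRing.Theory Num.Theory.
Export numFieldNormedType.Exports.

Set Implicit Arguments.
Unset Strict Implicit.
Unset Printing Implicit Defensive.

Local Open Scope classical_set_scope.
Local Open Scope ring_scope.

(* A real Hilbert space is a complete normed space H over a realType together
   with a positive definite symmetric bilinear form that induces its norm. *)
Definition induces_norm (R : realType) (H : completeNormedModType R)
    (ip : {dot H for idfun}) :=
  forall x : H, `|x| = Num.sqrt (ip x x).

Section operators.
Context {R : realType} {H : completeNormedModType R}.
Variable ip : {dot H for idfun}.

Definition bounded_op (U : H -> H) :=
  exists M : R, forall x, `|U x| <= M * `|x|.

(* The value is meaningful for bounded U only: sup is 0 on unbounded sets. *)
Definition opnorm (U : H -> H) : R :=
  sup [set `|U x| | x in [set x : H | `|x| <= 1]].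

Definition self_adjoint (U : H -> H) := forall x y, ip (U x) y = ip x (U y).

Definition loewner_ge (U V : H -> H) := forall x, ip (U x) x >= ip (V x) x.

Definition calP (alpha : R) : set {linear H -> H} :=
  [set U | [/\ bounded_op U, self_adjoint U &
               loewner_ge U (fun x => alpha *: x)]].

(* For U in calP alpha with alpha > 0, U is bijective, so that this is the
   inverse operator. *)
Definition inv_op (U : H -> H) (x : H) : H := get [set y | U y = x].

Definition inv_norm (U : H -> H) (x : H) : R := Num.sqrt (ip (inv_op U x) x).

(* The projector relative to inv_norm U: the minimizer exists and is unique
   when C is nonempty, closed and convex and U is in calP alpha, alpha > 0. *)
Definition inv_proj (U : H -> H) (C : set H) (x : H) : H :=
  get [set p | C p /\
               forall y, C y -> inv_norm U (x - p) <= inv_norm U (x - y)].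

(* The Riesz representative of the Frechet differential of f at x. *)
Definition gradient (f : H -> R) (x : H) : H :=
  get [set g : H | forall v, 'd f x v = ip g v].

Definition weak_cvg (u : nat -> H) (l : H) :=
  forall v, ip (u k) v @[k --> \oo] --> ip l v.

End operators.

Definition proper_function (R : realType) (T : Type) (g : T -> \bar R) :=
  (exists x, (g x < +oo)%E) /\ forall x, (-oo < g x)%E.

Definition constrained_argmin (R : realType) (T : Type) (f : T -> R)
    (C : set T) : set T :=
  [set x | C x /\ forall y, C y -> f x <= f y].

Definition summable_seq (R : realType) (u : nat -> R) := cvgn (series u).

(* Main.v *)
From HB Require Import structures.
Require Import Defs.
From mathcomp Require Import ring lra.

(** Write W_k for the inverse of U_k, N_k(v)^2 = <W_k v, v>, B for the gradient
of f, p_k for the projection in the metric N_k of x_k - gamma_k U_k B x_k onto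
C, z_k = x_k - p_k for the residual, and theta_k = gamma_k |U_k| L / 2, so that
1 / alpha_k = 2 - theta_k.

Quasi-Fejer monotonicity. The variational inequality that characterizes p_k,
the optimality condition at a solution xs, and the cocoercivity of B (the
Baillon-Haddad theorem, [cocoercive]) combine into [forward_backward_step]: a
step without error decreases N_k(x_k - xs)^2 by at least
  lambda_k (2 - theta_k - lambda_k) N_k(z_k)^2
    + (lambda_k / theta_k) alpha |s_k|^2,
where s_k = gamma_k (B x_k - B xs) - theta_k W_k z_k.  The errors a_k, b_k and
the changes of metric only cost summable perturbations, so [quasi_fejer] makes
N_k(x_k - xs) converge, which is (i), and makes the decrease tend to 0
([fejer]).  Since lambda_k is bounded below, s_k tends to 0.

Vanishing of the residual.  Under (A) the factor of N_k(z_k)^2 is bounded below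
and (ii) is immediate.  Under (B) this factor may be arbitrarily small, and the
argument rests on s_k -> 0 instead ([residual_cvg0_slow]).  That limit says that
W_k z_k / gamma_k - B x_k, which is normal to C at p_k, is a positive multiple of
W_k z_k up to a constant and a vanishing term; monotonicity of the normal cone
between two consecutive points then gives
  N_{k+1}(z_{k+1})^2 + c |z_{k+1} - z_k|^2 <= N_k(z_k)^2 + o(1).
If z_k did not tend to 0, the residual would be almost constant and bounded away
from 0 over arbitrarily long stretches of indices, and x_k, which moves by
-lambda_k z_k, would leave every bounded set; [lyapunov_vanish] makes this
quantitative.  Apart from uniform bounds, the metrics enter only through the
fact that (W_k - W_{k+1}) v_k tends to 0 for every bounded sequence v_k.  As v_k
depends on k, this does not follow termwise from the summability of |(W_k - W_{k+1}) v| for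
fixed v: it is extracted from it by the Banach-Steinhaus theorem and a choice
of signs ([strongly_summable_cvg0]).

Conclusion.  Once z_k tends to 0, s_k -> 0 reads B x_k -> B xs, which is (iv).
Weak limits are taken along ultrafilters on the indices, and exist by the Riesz
theorem.  They are solutions ([cluster_optimal]), because p_k - x_k and W_k z_k
tend to 0 and B x_k converges strongly.  They all coincide ([cluster_unique]) by
Opial's argument, which needs W_k v to converge for each fixed v; this follows
from the almost monotonicity of the metrics ([almost_decreasing_cvg]).  This
proves (iii).

The surjectivity of U_k, the projections and the gradient all come from one
existence theorem for symmetric variational inequalities ([stampacchia]). *)

Set Implicit Arguments.
Unset Strict Implicit.
Unset Printing Implicit Defensive.

Local Open Scope classical_set_scope.
Local Open Scope ring_scope.

(** * Real sequences with summable perturbations *)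
Section real_sequences.
Context {R : realType}.
Implicit Types u s e d : nat -> R.

Lemma summable_cvg0 u : summable_seq u -> u k @[k --> \oo] --> 0.
Proof. exact: cvg_series_cvg_0. Qed.

Lemma summableD u v :
  summable_seq u -> summable_seq v -> summable_seq (fun k => u k + v k).
Proof. exact: is_cvg_seriesD. Qed.

Lemma summableZ c u : summable_seq u -> summable_seq (fun k => c * u k).
Proof. exact: is_cvg_seriesZ. Qed.

Lemma summable_ub u : (forall k, 0 <= u k) -> summable_seq u ->
  exists2 M, 0 <= M & forall n, series u n <= M.
Proof.
move=> u0 us; exists (limn (series u)).
  by apply: limr_ge => //; apply: nearW => n; apply: sumr_ge0.
move=> n; apply: nondecreasing_cvgn_le => //.
apply/nondecreasing_seqP => k; rewrite /series/= big_nat_recr//=.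
by rewrite lerDl.
Qed.

Lemma summable_bounded u : (forall k, 0 <= u k) -> summable_seq u ->
  exists2 M, 0 <= M & forall n, u n <= M.
Proof.
move=> u0 /(summable_ub u0)[M M0 uM]; exists M => // n.
apply: le_trans (uM n.+1); rewrite /series/= big_nat_recr//= lerDr.
exact: sumr_ge0.
Qed.

(** The partial products of 1 + e_k increase and stay below the exponential of
    the sum of the series. *)
Lemma growth_product_cvg e : (forall k, 0 <= e k) -> summable_seq e ->
  exists P : nat -> R, [/\ forall k, 1 <= P k,
    forall k, P k.+1 = (1 + e k) * P k & cvgn P].
Proof.
move=> e0 es; pose P n := \prod_(0 <= j < n) (1 + e j).
have P1 k : 1 <= P k.
  rewrite /P; elim: k => [|k ih]; first by rewrite big_nil.
  by rewrite big_nat_recr//=; apply: mulr_ege1 => //; rewrite lerDl.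
have PS k : P k.+1 = (1 + e k) * P k by rewrite /P big_nat_recr//= mulrC.
exists P; split => //.
apply: nondecreasing_is_cvgn.
  apply/nondecreasing_seqP => k; rewrite PS ler_peMl ?lerDl//.
  exact: le_trans ler01 (P1 k).
have [M M0 eM] := summable_ub e0 es.
exists (expR M) => _ [n _ <-]; apply: (@le_trans _ _ (expR (series e n))).
  rewrite /P /series/=; elim: n => [|n ih]; first by rewrite !big_nil expR0.
  rewrite !big_nat_recr//= expRD ler_pM ?expR_ge1Dx//.
    exact: le_trans ler01 (P1 n).
  by rewrite addr_ge0.
by rewrite ler_expR.
Qed.

(** Dividing by the products of 1 + e_k and subtracting the partial sums of d
    turns u into a nonincreasing sequence, so u converges; then s is squeezed by
    the difference of the two sides without s, which tends to 0. *)
Lemma quasi_fejer u s e d :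
  (forall k, 0 <= u k) -> (forall k, 0 <= s k) -> (forall k, 0 <= e k) ->
  (forall k, 0 <= d k) -> summable_seq e -> summable_seq d ->
  (forall k, u k.+1 + s k <= (1 + e k) * u k + d k) ->
  cvgn u /\ s k @[k --> \oo] --> 0.
Proof.
move=> u0 s0 e0 d0 es ds us.
have [P [P1 PS Pcvg]] := growth_product_cvg e0 es.
have P0 k : 0 < P k := lt_le_trans ltr01 (P1 k).
pose v k := u k / P k - series d k.
have vcvg : cvgn v.
  apply: nonincreasing_is_cvgn.
    apply/nonincreasing_seqP => k; rewrite /v PS /series/= big_nat_recr//=.
    have : u k.+1 / ((1 + e k) * P k) <= u k / P k + d k.
      rewrite ler_pdivrMr ?mulr_gt0//; last by rewrite ltr_pwDl.
      have -> : (u k / P k + d k) * ((1 + e k) * P k) =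
        (1 + e k) * u k + d k * ((1 + e k) * P k).
        by field; rewrite gt_eqF.
      have := us k; have := s0 k => h1 h2.
      have : d k <= d k * ((1 + e k) * P k).
        by rewrite ler_peMr// mulr_ege1// lerDl.
      by move=> h3; lra.
    by move=> h; lra.
  have [M M0 dM] := summable_ub d0 ds.
  exists (- M) => _ [n _ <-]; rewrite /v.
  have := dM n => h.
  have : 0 <= u n / P n by rewrite divr_ge0// ltW.
  by move=> h2; lra.
have ucvg : cvgn u.
  have -> : u = (fun k => (v k + series d k) * P k).
    by apply/funext => k; rewrite /v subrK mulfVK// gt_eqF.
  exact: (is_cvgM (is_cvgD vcvg ds) Pcvg).
split => //.
pose r k := (1 + e k) * u k + d k - u k.+1.
have rcvg : r k @[k --> \oo] --> 0.
  have -> : 0 = (1 + 0) * limn u + 0 - limn u by ring.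
  apply: cvgB; last by rewrite cvg_shiftS.
  apply: cvgD; last exact: summable_cvg0.
  apply: cvgM => //; apply: cvgD; first exact: cvg_cst.
  exact: summable_cvg0.
apply: (squeeze_cvgr _ (cvg_cst 0) rcvg).
by apply: nearW => k; rewrite s0/= /r; have := us k; lra.
Qed.

(** Once the error is below q del / 2, the excess of u over m + del / 2 is
    multiplied by at most 1 - q at each step. *)
Lemma contraction_limsup u (q m : R) (eps : nat -> R) : 0 < q <= 1 ->
  (forall k, u k.+1 <= (1 - q) * u k + q * m + eps k) ->
  eps k @[k --> \oo] --> 0 ->
  forall del, 0 < del -> \forall k \near \oo, u k <= m + del.
Proof.
move=> /andP[q0 q1] uS eps0 del del0.
have : \forall k \near \oo, eps k <= q * (del / 2).
  have qd : 0 < q * (del / 2) by rewrite mulr_gt0// divr_gt0.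
  move/cvgrPdist_le : eps0 => /(_ _ qd); apply: filterS => k.
  by rewrite sub0r normrN; apply: le_trans; apply: ler_norm.
move=> [n _ nP].
pose c := `|u n - m - del / 2|.
have ub k : u (n + k)%N <= m + del / 2 + (1 - q) ^+ k * c.
  elim: k => [|k ih].
    rewrite addn0 expr0 mul1r /c.
    by have := ler_norm (u n - m - del / 2); lra.
  rewrite addnS; apply: (le_trans (uS _)).
  have := nP (n + k)%N (leq_addr _ _) => /= e1.
  have : (1 - q) * u (n + k)%N <=
     (1 - q) * (m + del / 2 + (1 - q) ^+ k * c).
    by rewrite ler_wpM2l// subr_ge0.
  rewrite exprS; nra.
have geo : (1 - q) ^+ k * c @[k --> \oo] --> 0.
  rewrite -[X in _ --> X](mul0r c); apply: cvgM; last exact: cvg_cst.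
  by apply: cvg_expr; rewrite ger0_norm ?subr_ge0//; lra.
have d2 : 0 < del / 2 by rewrite divr_gt0.
move/cvgrPdist_le : geo => /(_ _ d2)[l _ lP].
exists (n + l)%N => //= k /= nlk.
have nk : (n <= k)%N by apply: leq_trans nlk; rewrite leq_addr.
have := ub (k - n)%N; rewrite subnKC//.
have := lP (k - n)%N; rewrite /= leq_subRL// => /(_ nlk).
rewrite sub0r normrN => h1 h2.
have := le_trans (ler_norm _) h1; lra.
Qed.

End real_sequences.

(** * Inner product and convergence *)
Section inner_product.
Context {R : realType} {H : completeNormedModType R}.
Variable ip : {dot H for idfun}.
Hypothesis ip_norm : induces_norm ip.
Implicit Types x y z : H.

Lemma ipC x y : ip x y = ip y x.
Proof. by rewrite hermitian_subproof expr0 mul1r. Qed.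

Lemma ipDl x y z : ip (x + y) z = ip x z + ip y z.
Proof. exact: linearDl. Qed.

Lemma ipNl x z : ip (- x) z = - ip x z.
Proof. exact: linearNl. Qed.

Lemma ipBl x y z : ip (x - y) z = ip x z - ip y z.
Proof. exact: linearBl. Qed.

Lemma ipZl a x z : ip (a *: x) z = a * ip x z.
Proof. exact: linearZl_LR. Qed.

Lemma ip0l z : ip 0 z = 0.
Proof. exact: linear0l. Qed.

Lemma ipDr x y z : ip z (x + y) = ip z x + ip z y.
Proof. by rewrite ipC ipDl !(ipC z). Qed.

Lemma ipNr x z : ip z (- x) = - ip z x.
Proof. by rewrite ipC ipNl (ipC z). Qed.

Lemma ipBr x y z : ip z (x - y) = ip z x - ip z y.
Proof. by rewrite ipC ipBl !(ipC z). Qed.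

Lemma ipZr a x z : ip z (a *: x) = a * ip z x.
Proof. by rewrite ipC ipZl (ipC z). Qed.

Lemma ip0r z : ip z 0 = 0.
Proof. by rewrite ipC ip0l. Qed.

Definition ipE := (ipDl, ipDr, ipNl, ipNr, ipZl, ipZr, ip0l, ip0r).

Lemma ip_ge0 x : 0 <= ip x x.
Proof.
have [->|x0] := eqVneq x 0; first by rewrite ip0l.
by apply/ltW/neq0_dnorm_gt0.
Qed.

Lemma sqnormE x : `|x| ^+ 2 = ip x x.
Proof. by rewrite ip_norm sqr_sqrtr// ip_ge0. Qed.

Lemma ip_le_norm x y : `|ip x y| <= `|x| * `|y|.
Proof.
rewrite -ler_sqr ?nnegrE ?mulr_ge0//= real_normK ?num_real// exprMn !sqnormE.
have [->|y0] := eqVneq y 0; first by rewrite !ip0r expr0n mulr0.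
have y_gt0 : 0 < ip y y by apply: neq0_dnorm_gt0.
have := ip_ge0 (ip y y *: x - ip x y *: y).
by rewrite !ipE (ipC y x) => h; rewrite -(ler_pM2l y_gt0); lra.
Qed.

Lemma ip_le x y : ip x y <= `|x| * `|y|.
Proof. exact: le_trans (ler_norm _) (ip_le_norm x y). Qed.

Lemma ip_ext x y : (forall v, ip x v = ip y v) -> x = y.
Proof.
move=> xy; apply/eqP; rewrite -subr_eq0 -normr_eq0 -sqrf_eq0 sqnormE.
by rewrite ipBl xy subrr.
Qed.

End inner_product.

Section convergence.
Context {R : realType}.

Lemma cvg_dist_le {T : Type} {F : set_system T} {FF : Filter F}
  {V : normedModType R} (u : T -> V) (l : V) (d : T -> R) :
  (\forall k \near F, `|u k - l| <= d k) -> d k @[k --> F] --> 0 ->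
  u k @[k --> F] --> l.
Proof.
move=> ud d0; apply/cvgrPdist_le => e e0.
move/cvgrPdist_le : d0 => /(_ _ e0) d0.
near=> k; rewrite distrC; apply: (@le_trans _ _ (d k)).
  by near: k.
have : `|0 - d k| <= e by near: k.
by rewrite sub0r normrN; apply: le_trans; apply: ler_norm.
Unshelve. all: by end_near. Qed.

Lemma cvg_norm_le0 {T : Type} {F : set_system T} {FF : Filter F}
  {V : normedModType R} (u : T -> V) (d : T -> R) :
  (forall k, `|u k| <= d k) -> d k @[k --> F] --> 0 ->
  u k @[k --> F] --> (0 : V).
Proof.
by move=> ud; apply: cvg_dist_le; apply: nearW => k; rewrite subr0.
Qed.

Lemma cvg_dist0 {T : Type} {F : set_system T} {FF : Filter F}
  {V : normedModType R} (u : T -> V) (l : V) :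
  u k @[k --> F] --> l -> `|u k - l| @[k --> F] --> 0.
Proof.
move=> ul; have -> : 0 = `|l - l| by rewrite subrr normr0.
by apply: cvg_norm; apply: cvgB => //; exact: cvg_cst.
Qed.

Lemma cvg_sqr0 {T : Type} {F : set_system T} {FF : Filter F}
  {V : normedModType R} (u : T -> V) :
  `|u k| ^+ 2 @[k --> F] --> 0 -> u k @[k --> F] --> (0 : V).
Proof.
move=> u0; apply/cvgrPdist_le => e e0; have e2 : 0 < e ^+ 2 by rewrite exprn_gt0.
move/cvgrPdist_le : u0 => /(_ _ e2); apply: filterS => k.
by rewrite !sub0r !normrN normrX normr_id ler_sqr ?nnegrE// ltW.
Qed.

Lemma cvg0M_bounded {T : Type} {F : set_system T} {FF : Filter F}
  (u v : T -> R) (M : R) : u k @[k --> F] --> 0 -> (forall k, `|v k| <= M) ->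
  u k * v k @[k --> F] --> 0.
Proof.
move=> u0 vM; apply: (@cvg_norm_le0 _ _ _ _ _ (fun k => `|u k| * M)).
  by move=> k; rewrite normrM ler_wpM2l.
rewrite -[X in _ --> X](mul0r M); apply: cvgM; last exact: cvg_cst.
by rewrite -[X in _ --> X](@normr0 _ R); apply: cvg_norm.
Qed.

Context {H : completeNormedModType R}.
Variable ip : {dot H for idfun}.
Hypothesis ip_norm : induces_norm ip.

Lemma ip_cvg {T : Type} {F : set_system T} {FF : Filter F} (u v : T -> H) x y :
  u k @[k --> F] --> x -> v k @[k --> F] --> y ->
  ip (u k) (v k) @[k --> F] --> ip x y.
Proof.
move=> /cvg_dist0 ux /cvg_dist0 vy.
pose d k := `|u k - x| * `|v k - y| + `|u k - x| * `|y| + `|v k - y| * `|x|.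
apply: (@cvg_dist_le _ _ _ _ _ _ d).
  apply: nearW => k.
  have -> : ip (u k) (v k) - ip x y =
      ip (u k - x) (v k - y) + ip (u k - x) y + ip (v k - y) x.
    by rewrite !ipE (ipC ip (v k) x) (ipC ip y x); ring.
  apply: (le_trans (ler_normD _ _)); apply: lerD; last exact: ip_le_norm.
  by apply: (le_trans (ler_normD _ _)); apply: lerD; exact: ip_le_norm.
have -> : 0 = 0 * 0 + 0 * `|y| + 0 * `|x| :> R by ring.
by apply: cvgD; [apply: cvgD|]; apply: cvgM => //; exact: cvg_cst.
Qed.

(** The product of a weakly and a strongly convergent family converges, the
    former being bounded. *)
Lemma ip_cvg_weak {T : Type} {F : set_system T} {FF : Filter F}
  (u v : T -> H) x y M : (forall k, `|u k| <= M) ->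
  (forall h, ip (u k) h @[k --> F] --> ip x h) ->
  v k @[k --> F] --> y -> ip (u k) (v k) @[k --> F] --> ip x y.
Proof.
move=> uM ux vy.
have -> : (fun k => ip (u k) (v k)) = (fun k => ip (u k) (v k - y) + ip (u k) y).
  by apply/funext => k; rewrite -ipDr subrK.
rewrite -[X in _ --> X]add0r; apply: cvgD => //.
apply: (@cvg_norm_le0 _ _ _ _ _ (fun k => `|v k - y| * M)).
  move=> k; apply: (le_trans (ip_le_norm ip_norm _ _)).
  by rewrite mulrC ler_wpM2l.
rewrite -[X in _ --> X](mul0r M); apply: cvgM; last exact: cvg_cst.
exact: cvg_dist0.
Qed.

Lemma ip_cvg0 {T : Type} {F : set_system T} {FF : Filter F} (u v : T -> H) M :
  u k @[k --> F] --> (0 : H) -> (forall k, `|v k| <= M) ->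
  ip (u k) (v k) @[k --> F] --> 0.
Proof.
move=> u0 vM; apply: (@cvg_norm_le0 _ _ _ _ _ (fun k => `|u k| * M)).
  move=> k; apply: (le_trans (ip_le_norm ip_norm _ _)).
  by rewrite ler_wpM2l.
rewrite -[X in _ --> X](mul0r M); apply: cvgM; last exact: cvg_cst.
by rewrite -[X in _ --> X](@normr0 _ H); apply: cvg_norm.
Qed.

Lemma bounded_op_cvg {T : Type} {F : set_system T} {FF : Filter F}
  (S : {linear H -> H}) (u : T -> H) x : bounded_op S ->
  u k @[k --> F] --> x -> S (u k) @[k --> F] --> S x.
Proof.
move=> [M SM] /cvg_dist0 ux.
apply: (@cvg_dist_le _ _ _ _ _ _ (fun k => M * `|u k - x|)).
  by apply: nearW => k; rewrite -linearB.
by rewrite -[X in _ --> X](mulr0 M); apply: cvgM => //; exact: cvg_cst.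
Qed.

End convergence.

(** * Symmetric variational inequalities *)
Section variational_inequality.
Context {R : realType} {H : completeNormedModType R}.
Variable ip : {dot H for idfun}.
Hypothesis ip_norm : induces_norm ip.

Lemma convex_setE (C : set H) x y (t : R) : convex_set C -> C x -> C y ->
  0 <= t <= 1 -> C (x + t *: (y - x)).
Proof.
move=> Cc Cx Cy /andP[t0 t1].
have := Cc y x (Itv01 t0 t1); rewrite !inE => /(_ Cy Cx).
rewrite /conv/= /unstable.onem; congr (C _).
by rewrite scalerBl scalerBr scale1r addrCA.
Qed.

(** The first-order term of a quadratic that is nonnegative to the right of 0:
    divide by t and let t tend to 0. *)
Lemma quad_ge0 (A B : R) : (forall t, 0 < t -> t <= 1 -> 0 <= t * A + t ^+ 2 * B) ->
  0 <= A.
Proof.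
move=> h; rewrite leNgt; apply/negP => A0.
pose t := Num.min 1 (- A / (`|B| + 1) / 2).
have B1 : 0 < `|B| + 1 by rewrite ltr_wpDl.
have t0 : 0 < t by rewrite lt_min ltr01/= !divr_gt0 ?oppr_gt0.
have t1 : t <= 1 by rewrite ge_min lexx.
have tA : t * (`|B| + 1) <= - A / 2.
  rewrite -ler_pdivlMr//.
  have -> : - A / 2 / (`|B| + 1) = - A / (`|B| + 1) / 2 by ring.
  by rewrite ge_min lexx orbT.
have := h _ t0 t1; have := ler_norm B => h1.
have h2 : t * B <= t * (`|B| + 1) by rewrite ler_pM2l//; lra.
by rewrite expr2 -mulrA -mulrDr pmulr_rge0// => h3; lra.
Qed.

(** The solution minimizes the energy Q y = <S y, y> / 2 - l y over C.  The
    energy at the midpoint of two points falls below the mean of its values by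
    an eighth of <S d, d>, d the difference of the points; a minimizing sequence
    is therefore Cauchy, and the first-order condition at its limit is the
    variational inequality. *)
Lemma stampacchia (S : {linear H -> H}) (alpha : R) (C : set H) (l : H -> R)
    (M : R) :
  0 < alpha -> calP ip alpha S -> closed C -> convex_set C -> C !=set0 ->
  (forall a u v, l (a *: u + v) = a * l u + l v) ->
  (forall v, `|l v| <= M * `|v|) ->
  exists2 p, C p & forall y, C y -> l (y - p) <= ip (S p) (y - p).
Proof.
move=> a0 [Sb Ssa Sa] Ccl Cc [c0 Cc0] ll lM.
have lD u v : l (u + v) = l u + l v by rewrite -[u]scale1r ll mul1r scale1r.
have l0 : l 0 = 0.
  have := ll 1 0 0; rewrite scale1r addr0 mul1r => h.
  by apply: (@addrI _ (l 0)); rewrite -h addr0.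
have lZ a v : l (a *: v) = a * l v by rewrite -[a *: v]addr0 ll l0 addr0.
have lB u v : l (u - v) = l u - l v by rewrite lD -scaleN1r lZ mulN1r.
have Sco x : alpha * `|x| ^+ 2 <= ip (S x) x.
  by rewrite (sqnormE ip_norm); have := Sa x; rewrite ipZl.
pose Q y := ip (S y) y / 2 - l y.
have Qadd y v : Q (y + v) = Q y + (ip (S y) v - l v) + ip (S v) v / 2.
  rewrite /Q (linearD S) !ipE lD (Ssa v y) (ipC ip v (S y)); lra.
have Qlb y : - (M ^+ 2 / (2 * alpha)) <= Q y.
  have := Sco y; have := le_trans (ler_norm _) (lM y).
  set n := `|y|; move=> h1 h2.
  have : - (M ^+ 2 / (2 * alpha)) <= alpha * n ^+ 2 / 2 - M * n.
    rewrite -subr_ge0.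
    have -> : alpha * n ^+ 2 / 2 - M * n - - (M ^+ 2 / (2 * alpha)) =
      (alpha * n - M) ^+ 2 / (2 * alpha) by field; rewrite gt_eqF.
    by rewrite divr_ge0 ?sqr_ge0// mulr_ge0// ltW.
  rewrite /Q => h3; lra.
have Qhi : has_inf (Q @` C).
  split; first by exists (Q c0), c0.
  by exists (- (M ^+ 2 / (2 * alpha))) => _ [y _ <-].
pose m := inf (Q @` C).
have mQ y : C y -> m <= Q y.
  by move=> Cy; apply: ge_inf; [exact: Qhi.2 | exists y].
have [u /all_and2[Cu um]] :
    exists u : nat -> H, forall n, C (u n) /\ Q (u n) < m + n.+1%:R^-1.
  suff h n : exists y, C y /\ Q y < m + n.+1%:R^-1.
    by have [u uP] := choice h; exists u.
  have n0 : (0 : R) < n.+1%:R^-1 by rewrite invr_gt0.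
  by have [_ [y Cy <-] yQ] := inf_adherent n0 Qhi; exists y.
have udist n k : `|u n - u k| ^+ 2 <= 4 / alpha * (n.+1%:R^-1 + k.+1%:R^-1).
  have Cm : C (u n + 2^-1 *: (u k - u n)).
    by apply: convex_setE => //; lra.
  have := mQ _ Cm; have := um n; have := um k.
  have : Q (u k) = Q (u n + (u k - u n)) by rewrite addrC subrK.
  rewrite !Qadd (linearZ_LR S) !ipE lZ; have := Sco (u k - u n).
  rewrite !ipE (distrC (u k)) => h1 h2 h3 h4 h5.
  rewrite -ler_pdivrMl ?divr_gt0//.
  have -> : (4 / alpha)^-1 * `|u n - u k| ^+ 2 = alpha * `|u n - u k| ^+ 2 / 4.
    by field; rewrite gt_eqF.
  move: h1 h2 h3 h4 h5; move: (ip _ _ - ip _ _) (ip _ _ - ip _ _) => b a.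
  move: (n.+1%:R^-1) (k.+1%:R^-1) (`|_ - _| ^+ 2) => i j d2; lra.
have ucvg : cvgn u.
  apply: cauchy_cvg; apply: cauchy_exP => e e0.
  have e8 : 0 < alpha * e ^+ 2 / 16.
    by rewrite divr_gt0// mulr_gt0// exprn_gt0.
  have := @cvg_harmonic R; move/cvgr0Pnorm_le => /(_ _ e8)[N _ NP].
  exists (u N); exists N => //= n Nn.
  rewrite -ball_normE /ball_/= -(ltr_sqr (x := `|_|)) ?nnegrE// ?ltW//.
  apply: le_lt_trans (udist _ _) _.
  have := NP _ Nn; have := NP _ (leqnn N); rewrite /harmonic/=.
  rewrite !ger0_norm ?invr_ge0//.
  move: (N.+1%:R^-1) (n.+1%:R^-1) => i j h1 h2.
  have : 4 / alpha * (i + j) <=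
      4 / alpha * (alpha * e ^+ 2 / 8).
    by rewrite ler_pM2l ?divr_gt0//; lra.
  have -> : 4 / alpha * (alpha * e ^+ 2 / 8) = e ^+ 2 / 2.
    by field; rewrite gt_eqF.
  by have := exprn_gt0 2 e0; lra.
pose p := limn u.
have Cp : C p by apply: (@closed_cvg _ _ \oo _ u C) => //; apply: nearW.
have Qp : Q p <= m.
  have Qu : Q (u n) @[n --> \oo] --> Q p.
    apply: cvgB.
      apply: cvgM; last exact: cvg_cst.
      exact/(ip_cvg ip_norm)/ucvg/bounded_op_cvg/ucvg.
    apply: (@cvg_dist_le _ _ _ _ _ _ _ (fun n => M * `|u n - p|)).
      by apply: nearW => n; rewrite -lB.
    rewrite -[X in _ --> X](mulr0 M); apply: cvgM; first exact: cvg_cst.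
    exact: cvg_dist0.
  have mn : m + n.+1%:R^-1 @[n --> \oo] --> m.
    rewrite -[X in _ --> X]addr0; apply: cvgD; first exact: cvg_cst.
    exact: cvg_harmonic.
  by apply: (ler_cvg_to Qu mn); apply: nearW => n; apply/ltW.
exists p => // y Cy; rewrite -subr_ge0.
apply: (@quad_ge0 _ (ip (S (y - p)) (y - p) / 2)) => t t0 t1.
have Ct : C (p + t *: (y - p)) by apply: convex_setE => //; rewrite t1 ltW.
have := le_trans Qp (mQ _ Ct); rewrite Qadd (linearZ_LR S) lZ !ipZl !ipZr.
set a := ip (S p) _; set b := l _; set c := ip _ _; lra.
Qed.

End variational_inequality.

(** * Coercive self-adjoint operators and their inverses *)
Section operators.
Context {R : realType} {H : completeNormedModType R}.
Variable ip : {dot H for idfun}.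
Hypothesis ip_norm : induces_norm ip.

(** On the whole space both p + v and p - v are admissible, so the variational
    inequality is an equality. *)
Lemma lax_milgram (S : {linear H -> H}) (alpha : R) (l : H -> R) (M : R) :
  0 < alpha -> calP ip alpha S ->
  (forall a u v, l (a *: u + v) = a * l u + l v) ->
  (forall v, `|l v| <= M * `|v|) -> exists p, forall v, ip (S p) v = l v.
Proof.
move=> a0 Sa ll lM.
have convT : convex_set [set: H] by move=> x y t _ _; rewrite inE.
have [p _ pP] :=
  stampacchia ip_norm a0 Sa (@closedT H) convT (ex_intro _ 0 Logic.I) ll lM.
have l0 : l 0 = 0.
  have := ll 1 0 0; rewrite scale1r addr0 mul1r => h.
  by apply: (@addrI _ (l 0)); rewrite -h addr0.
exists p => v; apply/eqP; rewrite eq_le; apply/andP; split.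
  have := pP (p + (-1) *: v) Logic.I; rewrite addrAC subrr add0r.
  by rewrite -[(-1) *: v]addr0 ll l0 addr0 addr0 ipZr; lra.
by have := pP (p + v) Logic.I; rewrite addrAC subrr add0r.
Qed.

Lemma riesz (l : H -> R) (M : R) :
  (forall a u v, l (a *: u + v) = a * l u + l v) ->
  (forall v, `|l v| <= M * `|v|) -> exists p, forall v, ip p v = l v.
Proof.
apply: (@lax_milgram (idfun : {linear H -> H}) 1) => //; split => //.
  by exists 1 => x; rewrite mul1r.
by move=> x /=; rewrite scale1r.
Qed.

Lemma quadD (S : {linear H -> H}) x y : self_adjoint ip S ->
  ip (S (x + y)) (x + y) = ip (S x) x + 2 * ip (S x) y + ip (S y) y.
Proof.
move=> Ssa; rewrite (linearD S) !ipE (Ssa y x) (ipC ip y (S x)); ring.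
Qed.

Lemma quadB (S : {linear H -> H}) x y : self_adjoint ip S ->
  ip (S (x - y)) (x - y) = ip (S x) x - 2 * ip (S x) y + ip (S y) y.
Proof. by move=> Ssa; rewrite quadD// (linearN S) !ipE; ring. Qed.

(** Expand the nonnegative form at M x - S x and use its upper bound at S x. *)
Lemma psd_sqnorm_le (S : {linear H -> H}) (M : R) : 0 < M ->
  self_adjoint ip S -> (forall x, 0 <= ip (S x) x <= M * `|x| ^+ 2) ->
  forall x, `|S x| ^+ 2 <= M * ip (S x) x.
Proof.
move=> M0 Ssa SM x.
have /andP[h1 _] := SM (M *: x - S x); have /andP[_ h2] := SM (S x).
move: h1 h2; rewrite (linearB S) (linearZ_LR S) !ipE (Ssa (S x) x).
rewrite !(sqnormE ip_norm) => h1 h2.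
by rewrite -(ler_pM2l M0); nra.
Qed.

Lemma opnormP (U : {linear H -> H}) x :
  bounded_op U -> `|U x| <= opnorm U * `|x|.
Proof.
move=> [M UM].
have ub : has_ubound [set `|U x| | x in [set x : H | `|x| <= 1]].
  exists `|M| => _ [y /= y1 <-]; apply: (le_trans (UM y)).
  apply: (@le_trans _ _ (`|M| * `|y|)); first by rewrite ler_wpM2r// ler_norm.
  by rewrite ler_piMr.
have [->|x0] := eqVneq x 0; first by rewrite raddf0 !normr0 mulr0.
have nx : 0 < `|x| by rewrite normr_gt0.
rewrite -ler_pdivrMr// mulrC -[X in X * _]ger0_norm ?invr_ge0//.
rewrite -normrZ -(linearZ_LR U); apply: ub_le_sup => //.
exists (`|x|^-1 *: x) => //=.
by rewrite normrZ ger0_norm ?invr_ge0// mulVf// gt_eqF.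
Qed.

Lemma ip_opnorm_le (U : {linear H -> H}) x :
  bounded_op U -> ip (U x) x <= opnorm U * `|x| ^+ 2.
Proof.
move=> Ub; apply: (le_trans (ip_le ip_norm _ _)).
by rewrite expr2 mulrA ler_wpM2r// opnormP.
Qed.

Section inverse.
Variables (U : {linear H -> H}) (alpha : R).
Hypotheses (alpha_gt0 : 0 < alpha) (UP : calP ip alpha U).

Let Ub : bounded_op U. Proof. by case: UP. Qed.
Let Usa : self_adjoint ip U. Proof. by case: UP. Qed.

Lemma calP_coercive x : alpha * `|x| ^+ 2 <= ip (U x) x.
Proof. by rewrite (sqnormE ip_norm); case: UP => _ _ /(_ x); rewrite ipZl. Qed.

(** The hypothesis excludes the zero space, where the operator norm is 0. *)
Lemma alpha_le_opnorm : 0 < opnorm U -> alpha <= opnorm U.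
Proof.
move=> U0.
have [x x0] : exists x : H, x != 0.
  apply: contrapT => /forallNP h.
  suff : opnorm U = 0 by move=> e; rewrite e ltxx in U0.
  have hx (x : H) : x = 0 by have [//|xn0] := eqVneq x 0; case: (h x).
  rewrite /opnorm [X in sup X](_ : _ = [set 0]) ?sup1//.
  apply/seteqP; split => [_ [x _ <-]|_ ->] /=.
    by rewrite (hx (U x)) normr0.
  by exists 0; rewrite /= ?normr0// raddf0 normr0.
have := le_trans (calP_coercive x) (ip_opnorm_le x Ub).
by rewrite ler_pM2r// exprn_gt0// normr_gt0.
Qed.

(** Coercivity makes U injective and the Lax-Milgram theorem makes it
    surjective, so that the default value in the definition of inv_op is never
    used and inv_op U is linear. *)
Lemma calP_inverse : exists2 W : {linear H -> H},
  inv_op U = W & forall x, U (W x) = x.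
Proof.
have Uinj x y : U x = U y -> x = y.
  move=> e; apply/eqP; rewrite -subr_eq0 -normr_eq0 -sqrf_eq0.
  have := calP_coercive (x - y); rewrite (linearB U) e subrr ip0l => h.
  rewrite eq_le sqr_ge0 andbT.
  by rewrite -(ler_pM2l alpha_gt0) mulr0.
have UV x : U (inv_op U x) = x.
  have [|v|p pP] := @lax_milgram U alpha (ip x) `|x| alpha_gt0 UP.
  - by move=> a u v; rewrite !ipE.
  - exact: ip_le_norm.
  have Up : U p = x by apply: (@ip_ext _ _ ip) => // v.
  by have := @getPex _ [set y | U y = x] (ex_intro _ p Up).
have lin : linear (inv_op U).
  by move=> a x y; apply: Uinj; rewrite linearP !UV.
pose W : {linear H -> H} :=
  HB.pack (inv_op U) (GRing.isLinear.Build _ _ _ _ _ lin).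
by exists W.
Qed.

Variable W : {linear H -> H}.
Hypothesis UW : forall x, U (W x) = x.

Lemma inverse_self_adjoint : self_adjoint ip W.
Proof. by move=> x y; rewrite -{2}(UW x) Usa UW. Qed.

Lemma inverseK x : W (U x) = x.
Proof. by apply: (@ip_ext _ _ ip) => // v; rewrite inverse_self_adjoint Usa UW. Qed.

Lemma inverse_sqnorm_le x : alpha * `|W x| ^+ 2 <= ip (W x) x.
Proof. by apply: le_trans (calP_coercive _) _; rewrite UW ipC. Qed.

Lemma inverse_ge0 x : 0 <= ip (W x) x.
Proof.
by apply: le_trans (inverse_sqnorm_le x); rewrite mulr_ge0 ?sqr_ge0// ltW.
Qed.

Lemma inverse_norm_le x : `|W x| <= alpha^-1 * `|x|.
Proof.
have [->|W0] := eqVneq (W x) 0; first by rewrite normr0 mulr_ge0// invr_ge0 ltW.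
have Wn : 0 < `|W x| by rewrite normr_gt0.
rewrite ler_pdivlMl// -(ler_pM2r Wn) -mulrA -expr2.
by apply: le_trans (inverse_sqnorm_le x) _; rewrite mulrC ip_le.
Qed.

Lemma inverse_le x : ip (W x) x <= alpha^-1 * `|x| ^+ 2.
Proof.
apply: (le_trans (ip_le ip_norm _ _)).
by rewrite expr2 mulrA ler_wpM2r// inverse_norm_le.
Qed.

Lemma inverse_bounded : bounded_op W.
Proof. by exists alpha^-1; exact: inverse_norm_le. Qed.

(** This is psd_sqnorm_le for U at the point W x. *)
Lemma sqnorm_le_inverse x : 0 < opnorm U ->
  `|x| ^+ 2 <= opnorm U * ip (W x) x.
Proof.
move=> U0; have := @psd_sqnorm_le U (opnorm U) U0 Usa _ (W x).
rewrite UW (ipC ip x); apply => y; rewrite ip_opnorm_le// andbT.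
by apply: le_trans (calP_coercive y); rewrite mulr_ge0 ?sqr_ge0// ltW.
Qed.

(** The right-hand side is the maximum over h of the left-hand side, as one
    sees by completing the square: U is nonnegative at h - W x. *)
Lemma inverse_conjugate x h : 2 * ip h x - ip (U h) h <= ip (W x) x.
Proof.
have := calP_coercive (h - W x); rewrite (linearB U) UW !ipE.
rewrite (Usa h (W x)) UW (ipC ip x (W x)) (ipC ip x h) => h1.
have : 0 <= alpha * `|h - W x| ^+ 2 by rewrite mulr_ge0 ?sqr_ge0// ltW.
lra.
Qed.

Section projection.
Variables (C : set H).
Hypotheses (C0 : C !=set0) (Ccl : closed C) (Cc : convex_set C).
Hypotheses (U0 : 0 < opnorm U) (WE : inv_op U = W).

(** The solution p of the variational inequality in the metric W is a minimizer
    of the distance, and strict convexity identifies it with the minimizer that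
    inv_proj selects. *)
Lemma inv_projP x : C (inv_proj ip U C x) /\
  forall y, C y -> ip (W (x - inv_proj ip U C x)) (y - inv_proj ip U C x) <= 0.
Proof.
have WP : calP ip (opnorm U)^-1 W.
  split; [exact: inverse_bounded | exact: inverse_self_adjoint | move=> y].
  rewrite ipZl -(sqnormE ip_norm) ler_pdivrMl//; exact: sqnorm_le_inverse.
have iU0 : 0 < (opnorm U)^-1 by rewrite invr_gt0.
have [||p Cp pP] := @stampacchia _ _ _ ip_norm W _ C (ip (W x)) `|W x|
  iU0 WP Ccl Cc C0.
- by move=> a u v; rewrite !ipE.
- by move=> v; exact: ip_le_norm.
have vi y : C y -> ip (W (x - p)) (y - p) <= 0.
  by move=> /pP; rewrite (linearB W) ipBl; lra.
have sq y : ip (W (x - y)) (x - y) = ip (W (x - p)) (x - p)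
    - 2 * ip (W (x - p)) (y - p) + ip (W (y - p)) (y - p).
  rewrite -quadB; last exact: inverse_self_adjoint.
  by rewrite opprB addrA subrK.
have inv_norm_le y z : (inv_norm ip U (x - y) <= inv_norm ip U (x - z)) =
    (ip (W (x - y)) (x - y) <= ip (W (x - z)) (x - z)).
  by rewrite /inv_norm WE ler_sqrt// inverse_ge0.
rewrite /inv_proj; set A := [set q | _].
have [Cq qP] : A (get A).
  apply: (@getPex _ A); exists p; split => // y Cy; rewrite inv_norm_le (sq y).
  by have := vi _ Cy; have := inverse_ge0 (y - p); lra.
suff -> : get A = p by [].
apply/eqP; rewrite -subr_eq0 -normr_eq0 -sqrf_eq0 eq_le sqr_ge0 andbT.
apply: le_trans (sqnorm_le_inverse _ U0) _.
rewrite pmulr_rle0//.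
have := qP _ Cp; rewrite inv_norm_le (sq (get A)).
by have := vi _ Cq; lra.
Qed.

End projection.
End inverse.

(** Inversion reverses the order: <W2 x, x> is the maximum of
    2 <h, x> - <U2 h, h>, and U2 dominates U1 / (1 + eta). *)
Lemma inverse_loewner (U1 U2 W1 W2 : {linear H -> H}) (alpha eta : R) :
  0 < alpha -> calP ip alpha U1 -> calP ip alpha U2 -> 0 <= eta ->
  loewner_ge ip (fun x => (1 + eta) *: U2 x) U1 ->
  (forall x, U1 (W1 x) = x) -> (forall x, U2 (W2 x) = x) ->
  forall x, ip (W2 x) x <= (1 + eta) * ip (W1 x) x.
Proof.
move=> a0 U1P U2P e0 mono UW1 UW2 x; have e1 : 0 < 1 + eta by lra.
have := inverse_conjugate a0 U1P UW1 x ((1 + eta)^-1 *: W2 x).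
have := mono (W2 x); rewrite ipZl UW2 (linearZ_LR U1) !ipE (ipC ip x) => h1 h2.
rewrite mulrC -ler_pdivrMr//; apply: le_trans h2.
set c := ip (W2 x) x; set d := ip _ _ in h1 *.
have e2 : 0 < (1 + eta)^-1 by rewrite invr_gt0.
have : (1 + eta)^-1 * ((1 + eta)^-1 * d) <= (1 + eta)^-1 * c.
  by rewrite ler_pM2l// ler_pdivrMl.
by rewrite [c / _]mulrC; lra.
Qed.

End operators.

(** * Convex functions with a Lipschitz gradient *)
Section gradient_arithmetic.
Context {R : realType}.
Implicit Types fx fy fw : R.

(* The identity 1 + ... + m = m (m + 1) / 2 in the form of an induction step;
   E is the contribution of one unit of the sum. *)
Let descent_sum (r B D E fp fq fx : R) :
  fp <= fx + r * D + E * (r * (r + 1)) / 2 -> fq - B <= fp ->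
  B - D <= E * (r + 1) ->
  fq <= fx + (r + 1) * D + E * ((r + 1) * (r + 1 + 1)) / 2.
Proof.
move=> h1 h2 h3.
have -> : fx + (r + 1) * D + E * ((r + 1) * (r + 1 + 1)) / 2 =
  fx + r * D + E * (r * (r + 1)) / 2 + (D + E * (r + 1)) by field.
apply: (@le_trans _ _ (fp + B)); first by rewrite -lerBlDr.
by apply: lerD => //; rewrite -lerBlDl.
Qed.

Let bregman_sum fx fy fw (A B E Q : R) : fw <= fy + - A + Q ->
  fx + (E - B) <= fw -> fx + E + (A - B - Q) <= fy.
Proof. lra. Qed.

Let cocoercive_sum fx fy (A B D l : R) : fy + A + 2^-1 * l * D <= fx ->
  fx + - B + 2^-1 * l * D <= fy -> l * D <= B - A.
Proof. lra. Qed.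

Section gradient.
Context {H : completeNormedModType R}.
Variable ip : {dot H for idfun}.
Hypothesis ip_norm : induces_norm ip.
Variables (f : H -> R).
Hypothesis f_diff : forall x, differentiable f x.

(** The Riesz theorem makes the set from which gradient chooses nonempty. *)
Lemma gradientP x v : 'd f x v = ip (gradient ip f x) v.
Proof.
have /linear_lipschitz[k k0 fk] : continuous ('d f x).
  exact: diff_continuous (f_diff x).
have [|//|g gP] := @riesz _ _ _ ip_norm ('d f x) k.
  by move=> a u w; rewrite linearP.
rewrite /gradient; set A := [set g | _].
suff : A (get A) by apply.
by apply: (@getPex _ A); exists g => w; rewrite gP.
Qed.

(** One-sided directional differentiability, in the form that the comparisons
    below use. *)
Lemma gradient_approx x v e : 0 < e -> exists2 d, 0 < d &
  forall t, 0 < t -> t < d ->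
    `|f (x + t *: v) - f x - t * ip (gradient ip f x) v| <= e * t.
Proof.
move=> e0; have := @diff_derivable _ _ _ f x v (f_diff x).
rewrite /derivable => /cvgP; rewrite -[lim _]/('D_v f x) deriveE// gradientP.
move/cvgrPdist_le => /(_ _ e0); rewrite near_withinE => -[d /= d0 dP].
exists d => // t t0 td.
have := dP t; rewrite /ball_/= sub0r normrN gtr0_norm// => /(_ td).
rewrite gt_eqF// => /(_ isT); rewrite [t *: v + x]addrC => h.
set D := f _ - f x in h *; set g := ip _ _ in h *.
have -> : D - t * g = - (t * (g - t^-1 *: D)).
  by rewrite /GRing.scale/=; field; rewrite gt_eqF.
by rewrite normrN normrM gtr0_norm// mulrC ler_pM2r.
Qed.

Lemma gradient_le x v c :
  (forall t, 0 < t -> t <= 1 -> f (x + t *: v) - f x <= t * c) ->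
  ip (gradient ip f x) v <= c.
Proof.
move=> h; apply/ler_addgt0Pr => e e0.
have [d d0 dP] := gradient_approx x v e0.
pose t := Num.min 1 (d / 2).
have t0 : 0 < t by rewrite lt_min ltr01 divr_gt0.
have t1 : t <= 1 by rewrite ge_min lexx.
have td : t < d by rewrite gt_min; apply/orP; right; lra.
have := h _ t0 t1; have := dP _ t0 td; rewrite ler_norml => /andP[h1 _] h2.
by rewrite -(ler_pM2l t0); lra.
Qed.

Lemma gradient_ge x v c :
  (forall t, 0 < t -> t <= 1 -> t * c <= f (x + t *: v) - f x) ->
  c <= ip (gradient ip f x) v.
Proof.
move=> h; apply/ler_addgt0Pr => e e0.
have [d d0 dP] := gradient_approx x v e0.
pose t := Num.min 1 (d / 2).
have t0 : 0 < t by rewrite lt_min ltr01 divr_gt0.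
have t1 : t <= 1 by rewrite ge_min lexx.
have td : t < d by rewrite gt_min; apply/orP; right; lra.
have := h _ t0 t1; have := dP _ t0 td; rewrite ler_norml => /andP[_ h1] h2.
by rewrite -(ler_pM2l t0); lra.
Qed.

(** The function f does not decrease along the segment from a constrained
    minimizer to a point of C. *)
Lemma optimality (C : set H) xs y : convex_set C ->
  constrained_argmin f C xs -> C y -> 0 <= ip (gradient ip f xs) (y - xs).
Proof.
move=> Cc [Cxs xsP] Cy; apply: gradient_ge => t t0 t1.
by rewrite mulr0 subr_ge0 xsP//; apply: convex_setE => //; rewrite t1 ltW.
Qed.

Hypothesis f_convex : convex_function [set: H] f.

(** The difference quotient of a convex function at x along y - x is at most
    f y - f x. *)
Lemma gradient_ineq x y : f x + ip (gradient ip f x) (y - x) <= f y.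
Proof.
rewrite -lerBrDl; apply: gradient_le => t t0 t1.
have : f (t *: y + (1 - t) *: x) <= t * f y + (1 - t) * f x.
  by apply: (f_convex (Itv01 (ltW t0) t1)); rewrite inE.
have -> : t *: y + (1 - t) *: x = x + t *: (y - x).
  by rewrite scalerBl scalerBr scale1r addrCA.
lra.
Qed.

Variable L : R.
Hypothesis L_gt0 : 0 < L.
Hypothesis f_lip : L.-lipschitz (gradient ip f).

Lemma gradient_lip x y :
  `|gradient ip f x - gradient ip f y| <= L * `|x - y|.
Proof. by have := f_lip (x := (x, y)); apply. Qed.

(** Cut the segment from x to x + v into n equal pieces.  On each piece the
    increment of f is at most the derivative at the far endpoint, by convexity,
    and the Lipschitz bound controls that derivative.  The sum exceeds the
    claimed bound by a term of order 1 / n. *)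
Lemma descent x v :
  f (x + v) <= f x + ip (gradient ip f x) v + L / 2 * `|v| ^+ 2.
Proof.
set c := ip _ v; set K := L * `|v| ^+ 2.
have K0 : 0 <= K by rewrite mulr_ge0 ?sqr_ge0// ltW.
have step (h : R) m : 0 <= h -> f (x + (m%:R * h) *: v) <=
    f x + m%:R * h * c + K * h ^+ 2 * (m%:R * (m%:R + 1)) / 2.
  move=> h0; elim: m => [|m ih].
    by rewrite !mul0r scale0r !addr0 mulr0 mul0r addr0.
  set p := x + (m%:R * h) *: v in ih; set q := x + (m.+1%:R * h) *: v.
  have pq : p - q = - (h *: v).
    rewrite /p /q opprD addrACA subrr add0r -scalerBl -natr1.
    have -> : m%:R * h - (m%:R + 1) * h = - h by ring.
    by rewrite scaleNr.
  have := gradient_ineq q p; rewrite pq ipNr ipZr => h1.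
  have : ip (gradient ip f q) v - c <= L * (m.+1%:R * h) * `|v| ^+ 2.
    rewrite /c -ipBl; apply: (le_trans (ip_le ip_norm _ _)).
    rewrite expr2 [leRHS]mulrA ler_wpM2r//.
    apply: (le_trans (gradient_lip _ _)).
    rewrite /q addrAC subrr add0r normrZ ger0_norm ?mulr_ge0//.
    by rewrite !mulrA.
  have -> : L * (m.+1%:R * h) * `|v| ^+ 2 = K * h * (m%:R + 1).
    by rewrite /K -natr1; ring.
  move=> h2; have h3 : h * (ip (gradient ip f q) v - c) <= h * (K * h * (m%:R + 1)).
    by rewrite ler_wpM2l.
  have ds := @descent_sum m%:R (h * ip (gradient ip f q) v) (h * c)
    (K * h ^+ 2) (f p) (f q) (f x).
  have -> : m.+1%:R * h * c = (m%:R + 1) * (h * c) by rewrite -natr1 mulrA.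
  rewrite -natr1; apply: ds.
  - by rewrite mulrA.
  - exact: h1.
  - rewrite -mulrBr (le_trans h3)//.
    by have -> : K * h ^+ 2 * (m%:R + 1) = h * (K * h * (m%:R + 1)) by ring.
have bound n : f (x + v) <= f x + c + L / 2 * `|v| ^+ 2 + K / 2 * n.+1%:R^-1.
  have := @step n.+1%:R^-1 n.+1; rewrite invr_ge0 ler0n => /(_ isT).
  rewrite mulfV ?pnatr_eq0// scale1r mul1r => /le_trans; apply.
  rewrite le_eqVlt; apply/orP; left; apply/eqP.
  have : (n.+1%:R : R) != 0 by rewrite pnatr_eq0.
  by rewrite /K; move: (n.+1%:R : R) => r r0; field.
have := @cvg_harmonic R => har.
have lim : f x + c + L / 2 * `|v| ^+ 2 + K / 2 * n.+1%:R^-1 @[n --> \oo] -->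
    f x + c + L / 2 * `|v| ^+ 2.
  rewrite -[X in _ --> X]addr0 -[X in _ --> _ + X](mulr0 (K / 2)).
  apply: cvgD; first exact: cvg_cst.
  by apply: cvgM; first exact: cvg_cst.
by apply: (ler_cvg_to (cvg_cst _) lim); apply: nearW.
Qed.

(** Compare, at the point reached from y by a gradient step of length 1 / L for
    the function f - <B x, .>, the lower bound given by convexity at x and the
    upper bound given by the descent inequality at y. *)
Lemma bregman_ge x y :
  f x + ip (gradient ip f x) (y - x) +
    (2 * L)^-1 * `|gradient ip f y - gradient ip f x| ^+ 2 <= f y.
Proof.
set d := _ - gradient ip f x.
have nd : `|- (L^-1 *: d)| = L^-1 * `|d|.
  by rewrite normrN normrZ gtr0_norm// invr_gt0.
have dd : `|d| ^+ 2 = ip (gradient ip f y) d - ip (gradient ip f x) d.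
  by rewrite -ipBl (sqnormE ip_norm).
have h1 := descent y (- (L^-1 *: d)); rewrite nd ipNr ipZr in h1.
have h2 := gradient_ineq x (y - L^-1 *: d).
rewrite [y - _ - x]addrAC ipBr ipZr in h2.
have -> : (2 * L)^-1 * `|d| ^+ 2 = L^-1 * `|d| ^+ 2 - L / 2 * (L^-1 * `|d|) ^+ 2.
  by field; rewrite gt_eqF.
rewrite [in L^-1 * _]dd mulrBr.
exact: bregman_sum h1 h2.
Qed.

(** The Baillon-Haddad theorem: add the two Bregman bounds obtained by
    exchanging x and y. *)
Lemma cocoercive x y : L^-1 * `|gradient ip f x - gradient ip f y| ^+ 2 <=
  ip (gradient ip f x - gradient ip f y) (x - y).
Proof.
have h1 := bregman_ge x y; have h2 := bregman_ge y x.
rewrite (distrC (gradient ip f y)) in h1.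
have e z : ip z (y - x) = - ip z (x - y) by rewrite -ipNr opprB.
rewrite e in h1; rewrite (ipBl ip (gradient ip f x)).
rewrite invfM in h1 h2; exact: cocoercive_sum h2 h1.
Qed.

End gradient.
End gradient_arithmetic.

(** * One step in a fixed metric *)
Section step_arithmetic.
Context {R : realType}.

(** In forward_backward_step, Wa stands for <W (x - xs), z>, ga and gz for the
    products of the gradient difference g with x - xs and z, gg for its square
    norm, Ug for <U g, g>, and aS for alpha |s|^2. *)
Lemma step_arith (lam theta gamma L n Z Wa gz ga gg Ug aS N : R) :
  0 <= lam -> 0 < theta -> theta = gamma * n * L / 2 -> 0 < gamma ->
  0 < n -> 0 < L -> Z - gamma * gz - Wa + gamma * ga <= 0 ->
  L^-1 * gg <= ga -> Ug <= n * gg ->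
  aS <= gamma ^+ 2 * Ug - 2 * gamma * theta * gz + theta ^+ 2 * Z ->
  N - 2 * (lam * Wa) + lam ^+ 2 * Z <=
    N - lam * (2 - theta - lam) * Z - lam / theta * aS.
Proof.
move=> lam0 th0 thE g0 n0 L0 h1 h2 h3 h4.
have h5 : gg <= L * ga by rewrite -ler_pdivrMl.
have h6 : gamma ^+ 2 * Ug <= 2 * theta * gamma * ga.
  have -> : 2 * theta * gamma * ga = gamma ^+ 2 * (n * (L * ga)).
    by rewrite thE; field.
  rewrite ler_pM2l ?exprn_gt0//; apply: le_trans h3 _.
  by rewrite ler_pM2l.
have h7 : theta^-1 * aS <= 2 * gamma * ga - 2 * gamma * gz + theta * Z.
  rewrite ler_pdivrMl//.
  have -> : theta * (2 * gamma * ga - 2 * gamma * gz + theta * Z) =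
    2 * theta * gamma * ga - 2 * gamma * theta * gz + theta ^+ 2 * Z by ring.
  by lra.
have h8 : 0 <= lam * (2 * Wa - (2 - theta) * Z - theta^-1 * aS).
  by rewrite mulr_ge0//; lra.
have -> : N - lam * (2 - theta - lam) * Z - lam / theta * aS =
  N - 2 * (lam * Wa) + lam ^+ 2 * Z +
    lam * (2 * Wa - (2 - theta) * Z - theta^-1 * aS) by ring.
by rewrite lerDl.
Qed.

Lemma young_arith (del N V Q ia : R) : 0 < del ->
  0 <= del ^+ 2 * N - 2 * (del * Q) + V ->
  V <= ia * del ^+ 2 ->
  N + 2 * Q + V <= (1 + del) * N + ia * (del + del ^+ 2).
Proof.
move=> d0 h1 h2.
have : 0 <= del * N - 2 * Q + ia * del.
  rewrite -(pmulr_rge0 _ d0).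
  have -> : del * (del * N - 2 * Q + ia * del) =
    del ^+ 2 * N - 2 * (del * Q) + ia * del ^+ 2 by ring.
  by lra.
lra.
Qed.

End step_arithmetic.

Section metric_steps.
Context {R : realType} {H : completeNormedModType R}.
Variable ip : {dot H for idfun}.
Hypothesis ip_norm : induces_norm ip.

Section metric.
Variables (U W : {linear H -> H}) (alpha : R).
Hypotheses (alpha_gt0 : 0 < alpha) (UP : calP ip alpha U).
Hypotheses (UW : forall x, U (W x) = x) (U0 : 0 < opnorm U).

Let Wsa : self_adjoint ip W. Proof. exact (inverse_self_adjoint UP UW). Qed.

(** Here s = gamma g - theta W z with g = Bx - Bs.  Adding the variational
    inequality at p, tested at xs, to the optimality condition at xs bounds
    <W (x - xs), z> below by N(z)^2 + gamma <g, x - xs> - gamma <g, z>.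
    Cocoercivity bounds <g, x - xs> below by a multiple of <U g, g>, and the
    resulting quadratic form in g and z is completed to the square
    <U s, s> / theta, which is at least alpha |s|^2 / theta.  Keeping this
    square is what later gives the convergence of the gradients. *)
Lemma forward_backward_step (x p xs Bx Bs : H) (gamma L lam theta : R) :
  theta = gamma * opnorm U * L / 2 -> 0 < gamma -> 0 < L -> 0 <= lam ->
  ip (W (x - p) - gamma *: Bx) (xs - p) <= 0 ->
  0 <= ip Bs (p - xs) ->
  L^-1 * `|Bx - Bs| ^+ 2 <= ip (Bx - Bs) (x - xs) ->
  ip (W (x - lam *: (x - p) - xs)) (x - lam *: (x - p) - xs) <=
    ip (W (x - xs)) (x - xs) - lam * (2 - theta - lam) * ip (W (x - p)) (x - p)
    - lam / theta *
      (alpha * `|gamma *: (Bx - Bs) - theta *: W (x - p)| ^+ 2).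
Proof.
move=> thE g0 L0 lam0 h1 h2 h3.
set z := x - p in h1 *; set a := x - xs in h3 *.
have -> : x - lam *: z - xs = a - lam *: z by rewrite addrAC.
have e1 : xs - p = z - a by rewrite /z /a opprB [RHS]addrC addrA subrK.
have e2 : p - xs = a - z by rewrite -[RHS]opprB -e1 opprB.
rewrite e1 in h1; rewrite e2 in h2; set g := Bx - Bs in h3 *.
have gE : g = Bx - Bs by []; clearbody z a g.
have Ub : bounded_op U by case: UP.
rewrite quadB// ipZr (linearZ_LR W) ipZl ipZr.
have -> : lam * (lam * ip (W z) z) = lam ^+ 2 * ip (W z) z by ring.
apply: (step_arith (gz := ip g z) _ lam0 _ thE g0 U0 L0 _ h3
  (ip_opnorm_le ip_norm g Ub)).
- by rewrite thE divr_gt0// !mulr_gt0.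
- have : gamma * ip Bs (a - z) >= 0 by rewrite mulr_ge0// ltW.
  move: h1; rewrite gE !ipE (Wsa z a) (ipC ip z (W a)).
  move=> h1 h4; have e (A B D E F G : R) :
    (A - gamma * D) - (B - gamma * E) <= 0 -> 0 <= gamma * (F - G) ->
    A - gamma * (D - G) - B + gamma * (E - F) <= 0 by move=> ? ?; lra.
  by apply: e.
- apply: le_trans (calP_coercive ip_norm UP _) _.
  have Usa : self_adjoint ip U by case: UP.
  rewrite quadB// !(linearZ_LR U) !ipE UW (Usa g (W z)) UW (ipC ip z (W z)).
  by rewrite le_eqVlt; apply/orP; left; apply/eqP; ring.
Qed.

(** Young's inequality with the weight del, so that a summable bound on the
    perturbation yields a summable relative and a summable absolute error. *)
Lemma quad_perturbation (u v : H) (del : R) : `|v| <= del ->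
  ip (W (u + v)) (u + v) <=
    (1 + del) * ip (W u) u + alpha^-1 * (del + del ^+ 2).
Proof.
move=> vd; have del0 : 0 <= del := le_trans (normr_ge0 _) vd.
rewrite quadD//.
have [d0|dn0] := eqVneq del 0.
  move: vd; rewrite d0 normr_le0 => /eqP ->.
  by rewrite !ip0r expr0n/= !mulr0 !addr0 mulr0 addr0 mul1r.
have d0 : 0 < del by rewrite lt_neqAle eq_sym dn0.
apply: young_arith => //.
  have := inverse_ge0 ip_norm alpha_gt0 UP UW (del *: u - v).
  by rewrite quadB// (linearZ_LR W) !ipE mulrA -expr2.
apply: (le_trans (inverse_le ip_norm alpha_gt0 UP UW v)).
rewrite ler_wpM2l ?invr_ge0 ?(ltW alpha_gt0)//.
by rewrite ler_sqr ?nnegrE.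
Qed.

(** The two projections p of y and q of y + U h in the metric W satisfy
    N(q - p)^2 <= <h, q - p>: the metric cancels the operator U. *)
Lemma projection_perturbation (C : set H) (y p q h : H) :
  C p -> C q ->
  (forall w, C w -> ip (W (y - p)) (w - p) <= 0) ->
  (forall w, C w -> ip (W (y + U h - q)) (w - q) <= 0) ->
  `|p - q| <= opnorm U * `|h|.
Proof.
move=> Cp Cq /(_ _ Cq) h1 /(_ _ Cp) h2.
have WU : W (U h) = h := inverseK ip_norm UP UW h.
have key : ip (W (q - p)) (q - p) <= ip h (q - p).
  have e : W (y + U h - q) = W (y - p) + h - W (q - p).
    by rewrite -{2}WU -!(linearD W) -(linearB W) opprB [y - p + _]addrAC
      addrA subrK.
  move: h2; rewrite e -(opprB q p) ipNr ipBl ipDl; lra.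
have [->|pq] := eqVneq p q; first by rewrite subrr normr0 mulr_ge0// ltW.
have n0 : 0 < `|p - q| by rewrite normr_gt0 subr_eq0.
rewrite -(ler_pM2r n0) -expr2 distrC -mulrA.
apply: (le_trans (sqnorm_le_inverse ip_norm alpha_gt0 UP UW _ U0)).
by rewrite ler_pM2l// (le_trans key)// ip_le.
Qed.

End metric.
End metric_steps.

(** * A Lyapunov argument for slowly varying residuals *)
Section lyapunov.
Context {R : realType}.

(** In lyapunov_vanish, D is the norm of d = z_{k+1} - z_k, d2 its square, zz the
    square norm of z_k, xz and xz' are two successive values of <x_k, z_k>, and
    P1, P2, P3 stand for <z_k, d>, <r_k, z_{k+1}> and <x_k, d>. *)
Lemma lyapunov_arith (A A' c d2 D e lam0 lam zz xz xz' M rn t P1 P2 P3 : R) :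
  0 < c -> 0 <= t -> D ^+ 2 = d2 -> A' + c * d2 <= A + e ->
  xz' - xz = - (lam * zz) - lam * P1 + P2 + P3 ->
  lam0 * zz <= lam * zz -> - (lam * P1) <= 2 * M * D -> P2 <= M * rn ->
  P3 <= M * D ->
  A' + t * xz' <= A + t * xz - t * lam0 * zz +
     t ^+ 2 * (9 * M ^+ 2 / (4 * c)) + (e + t * (M * rn)).
Proof.
move=> c0 t0 Dd hA hx h1 h2 h3 h4.
have h5 : t * (xz' - xz) <= t * (- (lam0 * zz) + 3 * M * D + M * rn).
  by rewrite ler_wpM2l//; lra.
have h6 : t * (3 * M * D) <= c * d2 + t ^+ 2 * (9 * M ^+ 2 / (4 * c)).
  rewrite -subr_ge0.
  have -> : c * d2 + t ^+ 2 * (9 * M ^+ 2 / (4 * c)) - t * (3 * M * D) =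
    c * (D - t * (3 * M) / (2 * c)) ^+ 2.
    by rewrite -Dd; field; rewrite gt_eqF.
  by rewrite mulr_ge0 ?sqr_ge0// ltW.
have -> : t * (M * rn) = t * (- (lam0 * zz) + 3 * M * D + M * rn) +
  t * lam0 * zz - t * (3 * M * D) by ring.
move: h5; rewrite mulrBr; move: h6 hA.
move: (t * _) (t * xz) (t * xz') => *; lra.
Qed.

Context {H : completeNormedModType R}.
Variable ip : {dot H for idfun}.
Hypothesis ip_norm : induces_norm ip.

(** As x moves by -lam_k z_k up to a vanishing error, <x_k, z_k> decreases by
    lam0 |z_k|^2 up to O(|z_{k+1} - z_k|) and a vanishing error.  For small t the
    term t O(|z_{k+1} - z_k|) is absorbed by c |z_{k+1} - z_k|^2 at the cost of
    O(t^2), so that A_k + t <x_k, z_k> is contracted at a rate of order t towards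
    a value of order t.  Hence the upper limit of A is O(t) for every small t. *)
Lemma lyapunov_vanish (x z r : nat -> H) (A lam e : nat -> R)
    (M Ca c lam0 : R) :
  0 < Ca -> 0 < c -> 0 < lam0 ->
  (forall k, `|x k| <= M) -> (forall k, `|z k| <= M) ->
  (forall k, 0 <= A k <= Ca * `|z k| ^+ 2) ->
  (forall k, lam0 <= lam k <= 2) ->
  (forall k, A k.+1 + c * `|z k.+1 - z k| ^+ 2 <= A k + e k) ->
  (forall k, x k.+1 = x k - lam k *: z k + r k) ->
  e k @[k --> \oo] --> 0 -> r k @[k --> \oo] --> (0 : H) ->
  A k @[k --> \oo] --> 0.
Proof.
move=> Ca0 c0 l0 xM zM AP lamP AS xS e0 r0.
have M0 : 0 <= M := le_trans (normr_ge0 _) (xM 0%N).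
pose K := M ^+ 2 + 9 * M ^+ 2 * Ca / (4 * c * lam0).
have K0 : 0 <= K.
  by rewrite addr_ge0 ?sqr_ge0// divr_ge0 ?mulr_ge0 ?sqr_ge0//; lra.
apply/cvgrPdist_le => eps eps0.
have KM : 0 < K + M ^+ 2 + 1 by have := sqr_ge0 M; lra.
(* The first bound gives q <= 1 below; the second makes the upper limit, of
   order t, at most eps / 2. *)
pose t := Num.min (Ca / lam0) (eps / 2 / (K + M ^+ 2 + 1)).
have t0 : 0 < t by rewrite lt_min !divr_gt0.
have tq : t <= Ca / lam0 by rewrite ge_min lexx.
have tK : t * (K + M ^+ 2) <= eps / 2.
  have : t * (K + M ^+ 2 + 1) <= eps / 2.
    by rewrite -ler_pdivlMr// ge_min lexx orbT.
  lra.
pose phi k := ip (x k) (z k).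
have phiM k : `|phi k| <= M ^+ 2.
  by apply: (le_trans (ip_le_norm ip_norm _ _)); rewrite expr2 ler_pM.
(* A bound q A_k <= t lam0 |z_k|^2 turns the decrease into a contraction. *)
pose q := t * lam0 / Ca.
have q01 : 0 < q <= 1.
  rewrite !divr_gt0 ?mulr_gt0//= ler_pdivrMr// mul1r -ler_pdivlMr//.
have step k : A k.+1 + t * phi k.+1 <= A k + t * phi k - t * lam0 * `|z k| ^+ 2
    + t ^+ 2 * (9 * M ^+ 2 / (4 * c)) + (e k + t * (M * `|r k|)).
  have /andP[lam1 lam2] := lamP k.
  apply: (@lyapunov_arith _ _ _ _ (`|z k.+1 - z k|) _ _ (lam k) _ _ _ _ _ _
    (ip (z k) (z k.+1 - z k)) (ip (r k) (z k.+1)) (ip (x k) (z k.+1 - z k)) 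
    c0 (ltW t0) erefl (AS k)).
  - rewrite /phi xS (sqnormE ip_norm) !ipE; ring.
  - by rewrite ler_wpM2r ?sqr_ge0.
  - apply: le_trans (ler_norm _) _; rewrite normrN normrM -mulrA.
    apply: ler_pM => //; first by rewrite ger0_norm//; lra.
    by apply: (le_trans (ip_le_norm ip_norm _ _)); rewrite ler_wpM2r.
  - apply: (le_trans (ip_le ip_norm _ _)); rewrite mulrC ler_wpM2r//.
  - by apply: (le_trans (ip_le ip_norm _ _)); rewrite ler_wpM2r.
pose err k := e k + t * (M * `|r k|).
have err0 : err k @[k --> \oo] --> 0.
  have -> : 0 = 0 + t * (M * `|0 : H|) by rewrite normr0 !mulr0 addr0.
  apply: cvgD => //; apply: cvgM; first exact: cvg_cst.
  by apply: cvgM; [exact: cvg_cst | exact: cvg_norm].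
have rec k : A k.+1 + t * phi k.+1 <=
    (1 - q) * (A k + t * phi k) + q * (t * K) + err k.
  apply: (le_trans (step k)); rewrite lerD2r.
  have h1 : q * A k <= t * lam0 * `|z k| ^+ 2.
    have /andP[_ h] := AP k; rewrite /q -mulrA ler_pM2l ?mulr_gt0//.
    by rewrite ler_pdivrMl.
  have h2 : q * (t * phi k) <= q * (t * M ^+ 2).
    have /andP[q0 _] := q01; rewrite ler_pM2l// ler_pM2l//.
    exact: le_trans (ler_norm _) (phiM k).
  have h3 : q * (t * K) = q * (t * M ^+ 2) + t ^+ 2 * (9 * M ^+ 2 / (4 * c)).
    by rewrite /q /K; field; rewrite !gt_eqF.
  rewrite h3 mulrBl mul1r mulrDr.
  move: h1 h2; clear; move: (q * A k) (q * (t * phi k)) (t * phi k) (A k).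
  move: (q * (t * _)) (t * lam0 * _) (t ^+ 2 * _) => *; lra.
have d0 : 0 < eps / 2 by rewrite divr_gt0.
have := contraction_limsup q01 rec err0 d0; apply: filterS => k h.
have /andP[A0 _] := AP k; rewrite sub0r normrN ger0_norm//.
have : - (t * phi k) <= t * M ^+ 2.
  rewrite -mulrN ler_pM2l//; apply: le_trans (ler_norm _) _.
  by rewrite normrN.
lra.
Qed.

End lyapunov.

(** * Sequences of self-adjoint operators *)
Section operator_sequences.
Context {R : realType} {H : completeNormedModType R}.
Variable ip : {dot H for idfun}.
Hypothesis ip_norm : induces_norm ip.

(** Choose signs inductively such that the square norm of the signed partial
    sums s_n of D_k v_k grows at each step by at least |D_k v_k|^2.  By
    self-adjointness |<s_n, x>| is at most B times the sum of the |D_k x|, so the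
    functionals <s_n, .> are pointwise bounded, hence bounded in norm by the
    Banach-Steinhaus theorem.  Thus the |D_k v_k|^2 are summable. *)
Lemma strongly_summable_cvg0 (D : nat -> H -> H) (v : nat -> H) (B : R) :
  (forall k, self_adjoint ip (D k)) ->
  (forall x, summable_seq (fun k => `|D k x|)) ->
  (forall k, `|v k| <= B) -> D k (v k) @[k --> \oo] --> (0 : H).
Proof.
move=> Dsa Dsum vB.
(* The sign that makes sg h w times <h, w> nonnegative. *)
pose sg (h w : H) : R := if 0 <= ip h w then 1 else -1.
pose s := fix s n := if n is m.+1 then
  s m + sg (s m) (D m (v m)) *: D m (v m) else 0.
have sgn h w : `|sg h w| = 1 by rewrite /sg; case: ifP; rewrite ?normrN normr1.
have sS n : `|s n| ^+ 2 + `|D n (v n)| ^+ 2 <= `|s n.+1| ^+ 2.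
  rewrite /= !(sqnormE ip_norm) !ipE (ipC ip _ (s n)).
  set w := D n (v n); rewrite /sg; case: ifPn; last rewrite -ltNge; lra.
have s_ub n x : `|ip (s n) x| <= B * series (fun k => `|D k x|) n.
  elim: n => [|n ih]; first by rewrite /= ip0l normr0 /series/= big_nil mulr0.
  rewrite /series/= big_nat_recr//= mulrDr ipDl ipZl.
  apply: (le_trans (ler_normD _ _)); apply: lerD => //.
  rewrite normrM sgn mul1r Dsa; apply: (le_trans (ip_le_norm ip_norm _ _)).
  by rewrite ler_wpM2r.
have B0 : 0 <= B := le_trans (normr_ge0 _) (vB 0%N).
pose F : set (H -> R^o) := [set (fun x => ip (s n) x : R^o) | n in [set: nat]].
have Fbl g : F g -> bounded_fun_norm g /\ linear g.
  move=> [n _ <-]; split; last by move=> a x y; rewrite !ipE.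
  move=> r; exists (`|s n| * r) => x xr.
  by apply: (le_trans (ip_le_norm ip_norm _ _)); rewrite ler_wpM2l.
have Fpt : pointwise_bounded F.
  move=> x; have [M M0 DM] := summable_ub (fun k => normr_ge0 (D k x)) (Dsum x).
  exists (B * M) => _ [n _ <-]; apply: (le_trans (s_ub n x)).
  by rewrite ler_wpM2l.
have [M FM] := Banach_Steinhauss Fbl Fpt 1.
have sM n : `|s n| <= M.
  have [s0|s0] := eqVneq (s n) 0.
    rewrite s0 normr0; apply: le_trans (FM _ _ 0 _); last by rewrite normr0.
      exact: normr_ge0.
    by exists n.
  have n0 : 0 < `|s n| by rewrite normr_gt0.
  have := FM _ (ex_intro2 _ _ n Logic.I erefl) (`|s n|^-1 *: s n).
  rewrite normrZ normfV normr_id mulVf ?gt_eqF// => /(_ (lexx _)).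
  rewrite ipZr -(sqnormE ip_norm) expr2 mulKf ?gt_eqF//.
  by rewrite ger0_norm.
apply: cvg_sqr0; apply: summable_cvg0.
have Sub n : series (fun k => `|D k (v k)| ^+ 2) n <= `|s n| ^+ 2.
  elim: n => [|n ih]; first by rewrite /series/= big_nil sqr_ge0.
  rewrite /series/= big_nat_recr//=; apply: le_trans (sS n).
  by rewrite lerD2r.
apply: nondecreasing_is_cvgn.
  apply/nondecreasing_seqP => n; rewrite /series/= big_nat_recr//= lerDl.
  exact: sqr_ge0.
exists (M ^+ 2) => _ [n _ <-]; apply: (le_trans (Sub n)).
by rewrite ler_sqr ?nnegrE//; exact: le_trans (sM n).
Qed.

(** After division by the products of 1 + eta_k the operators decrease.  For a
    decreasing sequence V of nonnegative operators, psd_sqnorm_le applied to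
    V_k - V_m bounds |V_k v - V_m v|^2 by the decrease of <V_k v, v>, a convergent
    real sequence. *)
Lemma almost_decreasing_cvg (W : nat -> {linear H -> H}) (M : R)
    (eta : nat -> R) :
  0 < M -> (forall k, self_adjoint ip (W k)) ->
  (forall k x, 0 <= ip (W k x) x <= M * `|x| ^+ 2) ->
  (forall k, 0 <= eta k) -> summable_seq eta ->
  (forall k x, ip (W k.+1 x) x <= (1 + eta k) * ip (W k x) x) ->
  forall v, cvgn (fun k => W k v).
Proof.
move=> M0 Wsa WM eta0 etas Wdec v.
have [P [P1 PS Pcvg]] := growth_product_cvg eta0 etas.
have P0 k : 0 < P k := lt_le_trans ltr01 (P1 k).
pose V k : {linear H -> H} := (P k)^-1 \*: W k.
pose q x k := ip (V k x) x.
have qE x k : q x k = (P k)^-1 * ip (W k x) x by rewrite /q /V/= ipZl.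
have q_ge0 x k : 0 <= q x k.
  rewrite qE mulr_ge0// ?invr_ge0 ?(ltW (P0 k))//.
  by have /andP[] := WM k x.
have qdec x : {homo q x : m n / (m <= n)%N >-> n <= m}.
  apply/nonincreasing_seqP => k; rewrite !qE PS ler_pdivrMl; last first.
    by rewrite mulr_gt0// ltr_pwDl.
  by rewrite mulrA mulfK ?gt_eqF.
have qcvg x : cvgn (q x).
  by apply: nonincreasing_is_cvgn => //; exists 0 => _ [n _ <-].
have qM x k : q x k <= M * `|x| ^+ 2.
  have /andP[h1 h2] := WM k x.
  rewrite qE ler_pdivrMl//; apply: (le_trans h2).
  by rewrite ler_peMl// mulr_ge0 ?sqr_ge0// ltW.
have Vdist k m : (k <= m)%N -> `|V k v - V m v| ^+ 2 <= M * (q v k - limn (q v)).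
  move=> km; pose S : {linear H -> H} := V k \- V m.
  have SE x : S x = V k x - V m x by [].
  have := @psd_sqnorm_le _ _ _ ip_norm S M M0 _ _ v.
  rewrite !SE ipBl => h; apply: le_trans (h _ _) _.
  - by move=> x y; rewrite !SE /V/= !ipE !Wsa.
  - move=> x; rewrite SE ipBl; have := qdec x _ _ km; have := qM x k.
    by have := q_ge0 x m; rewrite /q => h1 h2 h3; apply/andP; split; lra.
  - rewrite ler_pM2l// lerD2l lerN2.
    exact: (@nonincreasing_cvgn_ge _ (q v)).
have Vcvg : cvgn (fun k => V k v).
  apply: cauchy_cvg; apply: cauchy_exP => e e0.
  have eM : 0 < e ^+ 2 / M / 2 by rewrite !divr_gt0// exprn_gt0.
  have := qcvg v; move/cvgrPdist_le => /(_ _ eM)[N _ /(_ N (leqnn N)) /= NP].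
  exists (V N v); exists N => //= n Nn.
  rewrite -ball_normE /ball_/= -(ltr_sqr (x := `|_|)) ?nnegrE// ?ltW//.
  apply: le_lt_trans (Vdist _ _ Nn) _; rewrite mulrC -ltr_pdivlMr//.
  rewrite distrC in NP; have := le_trans (ler_norm _) NP; lra.
have -> : (fun k => W k v) = (fun k => P k *: V k v).
  by apply/funext => k; rewrite /V/= scalerA mulfV ?scale1r// gt_eqF.
exact: is_cvgZ.
Qed.

End operator_sequences.

(** * Weak limits along ultrafilters *)
Section weak_limits.
Context {R : realType}.

Lemma ultra_cvg_bounded (G : set_system nat) (u : nat -> R) (M : R) :
  UltraFilter G -> (forall k, `|u k| <= M) ->
  exists a : R, u k @[k --> G] --> a.
Proof.
move=> GU uM; have GP : ProperFilter G := @ultra_proper _ _ GU.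
have Gseg : G (u @^-1` `[- M, M]%classic).
  by apply: filterS filterT => k _ /=; rewrite in_itv/= -ler_norml.
have [a [_ aP]] := @segment_compact _ (- M) M (fmap u G) _ Gseg.
exists a => N Na.
have [//|GN] := in_ultra_setVsetC (u @^-1` N) GU.
by have [z [/= nz]] := aP (~` N) N GN Na.
Qed.

(** If the preimage of a neighbourhood N of l is not cofinite, some ultrafilter
    finer than the cofinite filter contains its complement. *)
Lemma cvg_ultra (u : nat -> R) (l : R) :
  (forall G, UltraFilter G -> \oo `<=` G -> u k @[k --> G] --> l) ->
  u k @[k --> \oo] --> l.
Proof.
move=> uG N Nl; apply: contrapT => nN.
pose F := within (~` (u @^-1` N)) \oo.
have FP : ProperFilter F.
  split; last exact: within_filter.
  rewrite /F /within => h; apply: nN; suff : \oo (u @^-1` N) by [].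
  move: h; apply: (@filterS nat eventually) => k h.
  by have [//|nk] := pselect (N (u k)); have [] := h nk.
have [G [GU FG]] := ultraFilterLemma FP.
have GP : ProperFilter G := @ultra_proper _ _ GU.
have sub : \oo `<=` G.
  by move=> A Aoo; apply: FG; apply: filterS Aoo => k.
have h1 : G (u @^-1` N) := uG G GU sub N Nl.
have h2 : G (~` (u @^-1` N)) by apply: FG; exact: withinT.
case: (filter_ex (filterI h1 h2)) => k [nk nnk]; exact: (nnk nk).
Qed.

Context {H : completeNormedModType R}.
Variable ip : {dot H for idfun}.
Hypothesis ip_norm : induces_norm ip.

(** Along an ultrafilter every bounded real sequence converges; the limits of
    the <x_k, v> define a bounded linear functional of v, which the Riesz theorem
    represents. *)
Lemma ultra_weak_limit (G : set_system nat) (x : nat -> H) (M : R) :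
  UltraFilter G -> (forall k, `|x k| <= M) ->
  exists p, forall v, ip (x k) v @[k --> G] --> ip p v.
Proof.
move=> GU xM; have GP : ProperFilter G := @ultra_proper _ _ GU.
have xvM v k : `|ip (x k) v| <= M * `|v|.
  by apply: (le_trans (ip_le_norm ip_norm _ _)); rewrite ler_wpM2r.
have [l lP] := choice (fun v => ultra_cvg_bounded GU (xvM v)).
have [|v|p pP] := @riesz _ _ _ ip_norm l M.
- move=> a u v; rewrite -(cvg_lim (@norm_hausdorff _ R) (lP (a *: u + v))).
  apply: cvg_lim => //.
  have -> : (fun k => ip (x k) (a *: u + v)) =
      (fun k => a * ip (x k) u + ip (x k) v).
    by apply/funext => k; rewrite !ipE.
  by apply: cvgD; [apply: cvgM; [exact: cvg_cst|] |]; exact: lP.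
- apply: (ler_cvg_to (cvg_norm (lP v)) (cvg_cst (M * `|v|))).
  by apply: nearW => k; exact: xvM.
by exists p => v; rewrite pP; exact: lP.
Qed.

End weak_limits.

(** * Identities and limits used along the iteration *)
Section arithmetic.
Context {R : realType}.

(** One step of the quasi-Fejer recursion: N is the squared distance after the
    step without error, X after the error, X' after the change of metric. *)
Lemma fejer_arith (N S X X' xi eta E del D ia : R) :
  0 <= N -> 0 <= S -> 0 <= eta -> eta <= E -> 0 <= del -> del <= D -> 0 < ia ->
  N <= xi - S -> X <= (1 + del) * N + ia * (del + del ^+ 2) ->
  X' <= (1 + eta) * X ->
  X' + S <= (1 + (eta + (1 + E) * del)) * xi + (1 + E) * (ia * (1 + D)) * del.
Proof.
move=> N0 S0 e0 eE d0 dD ia0 h1 h2 h3.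
have k1 : X' <= (1 + eta) * ((1 + del) * N + ia * (del + del ^+ 2)).
  by apply: (le_trans h3); rewrite ler_wpM2l//; lra.
have k2 : (1 + eta) * (1 + del) * N <= (1 + (eta + (1 + E) * del)) * N.
  apply: ler_wpM2r => //; rewrite -subr_ge0.
  have -> : 1 + (eta + (1 + E) * del) - (1 + eta) * (1 + del) = (E - eta) * del by ring.
  by rewrite mulr_ge0// subr_ge0.
have c0 : 0 <= (1 + E) * del by rewrite mulr_ge0//; lra.
have k3 : (1 + (eta + (1 + E) * del)) * N <=
    (1 + (eta + (1 + E) * del)) * (xi - S) by rewrite ler_wpM2l//; lra.
have k4 : 1 * S <= (1 + (eta + (1 + E) * del)) * S by rewrite ler_wpM2r//; lra.
have k5 : (1 + eta) * (ia * (del + del ^+ 2)) <= (1 + E) * (ia * (1 + D)) * del.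
  have -> : (1 + E) * (ia * (1 + D)) * del = (1 + E) * (ia * ((1 + D) * del)) by ring.
  apply: ler_pM; [lra | | lra |].
    by rewrite mulr_ge0 ?(ltW ia0)// addr_ge0 ?sqr_ge0.
  rewrite ler_pM2l// -subr_ge0.
  have -> : (1 + D) * del - (del + del ^+ 2) = (D - del) * del by ring.
  by rewrite mulr_ge0// subr_ge0.
move: k1; rewrite mulrDr mulrA; move: k2 k3 k4 k5; rewrite mulrBr mul1r.
move: ((1 + eta) * (1 + del) * N) ((1 + (eta + (1 + E) * del)) * N)
  ((1 + (eta + (1 + E) * del)) * xi) ((1 + (eta + (1 + E) * del)) * S)
  ((1 + eta) * (ia * (del + del ^+ 2))) ((1 + E) * (ia * (1 + D)) * del).
by clear; move=> *; lra.
Qed.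

Lemma cvg_bounded (u : nat -> R) : cvgn u -> exists M, forall k, `|u k| <= M.
Proof.
move=> /cvg_seq_bounded[M [_ MP]]; exists (M + 1) => k.
by apply: MP => //; rewrite ltrDl.
Qed.

Lemma scale_cvg0 {V : normedModType R} (c : nat -> R) (u : nat -> V) (K : R) :
  (forall k, `|c k| <= K) -> u k @[k --> \oo] --> (0 : V) ->
  c k *: u k @[k --> \oo] --> (0 : V).
Proof.
move=> cK u0; apply: (@cvg_norm_le0 _ _ _ _ _ _ (fun k => K * `|u k|)).
  by move=> k; rewrite normrZ ler_wpM2r.
have -> : 0 = K * `|0 : V| by rewrite normr0 mulr0.
by apply: cvgM; [exact: cvg_cst | exact: cvg_norm].
Qed.

Lemma scale0_cvg0 {V : normedModType R} (c : nat -> R) (u : nat -> V) (K : R) :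
  c k @[k --> \oo] --> 0 -> (forall k, `|u k| <= K) ->
  c k *: u k @[k --> \oo] --> (0 : V).
Proof.
move=> c0 uK; apply: (@cvg_norm_le0 _ _ _ _ _ _ (fun k => `|c k| * K)).
  by move=> k; rewrite normrZ ler_wpM2l.
have -> : 0 = `|0 : R| * K by rewrite normr0 mul0r.
by apply: cvgM; [exact: cvg_norm | exact: cvg_cst].
Qed.

Lemma cvg0B {V : normedModType R} (u v : nat -> V) :
  u k @[k --> \oo] --> (0 : V) -> v k @[k --> \oo] --> (0 : V) ->
  u k - v k @[k --> \oo] --> (0 : V).
Proof. by move=> u0 v0; rewrite -[X in _ --> X]subr0; exact: cvgB. Qed.

Lemma cvg0S {V : normedModType R} (u : nat -> V) :
  u k @[k --> \oo] --> (0 : V) -> u k.+1 @[k --> \oo] --> (0 : V).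
Proof. by move=> u0; rewrite cvg_shiftS. Qed.

(** The normal vector w / g - u, where w = W z and u is the gradient, rewritten
    by eliminating u through s = g (u - v) - t w. *)
Lemma normal_vector_identity {V : lmodType R} (g t : R) (w u v : V) :
  g != 0 ->
  g^-1 *: w - u = (1 - t) / g *: w - g^-1 *: (g *: (u - v) - t *: w) - v.
Proof.
move=> g0; have -> : (1 - t) / g = g^-1 - g^-1 * t by rewrite mulrBl mul1r mulrC.
rewrite scalerBl scalerBr !scalerA mulVf// scale1r [g^-1 * t]mulrC opprB addrA.
by rewrite subrK opprB addrA addrAC [_ + v - v]addrK.
Qed.

(** The difference of two consecutive normal vectors, divided by c; w' + D - w is
    the old metric applied to the increment of the residual. *)
Lemma variation_identity {V : lmodType R} (c c' : R) (w w' D s s' v : V) :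
  c != 0 ->
  c *: (w' + D - w + (c^-1 *: ((c' - c) *: w' - (s' - s)) - D)) =
  (c' *: w' - s' - v) - (c *: w - s - v).
Proof.
move=> c0; have -> : c' *: w' - s' - v - (c *: w - s - v) =
  c *: (w' - w) + ((c' - c) *: w' - (s' - s)).
  rewrite scalerBl scalerBr [c *: w' - _ + _]addrA.
  rewrite [c *: w' - _ + _]addrC [_ - _ + (_ - _)]addrA subrK.
  rewrite [- (_ - v)]opprB addrA subrK [- (s' - s)]opprB [- (_ - s)]opprB.
  by rewrite [s - _]addrC addrACA [- s' + s]addrC.
have -> : w' + D - w + (c^-1 *: ((c' - c) *: w' - (s' - s)) - D) =
  (w' - w) + c^-1 *: ((c' - c) *: w' - (s' - s)).
  by rewrite addrA addrAC [w' + D - w]addrAC addrK.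
by rewrite scalerDr scalerA mulfV// scale1r.
Qed.

Lemma relaxation_identity {V : zmodType} (x x' p p' lz : V) :
  p' - p = x' - (x - lz) - lz - (x' - p' - (x - p)).
Proof.
rewrite -[x' - _ - lz]addrA -opprD subrK [- (_ - (x - p))]opprB.
by rewrite addrA [x' - x + _]addrA subrK opprB addrC addrA subrK.
Qed.

(** The quotient of slowly varying sequences, the denominator being bounded
    below, varies slowly. *)
Lemma ratio_variation_cvg0 (g t : nat -> R) (gam0 : R) :
  0 < gam0 -> (forall k, gam0 <= g k) -> (forall k, 0 <= t k <= 1) ->
  g k.+1 - g k @[k --> \oo] --> 0 -> t k.+1 - t k @[k --> \oo] --> 0 ->
  (1 - t k.+1) / g k.+1 - (1 - t k) / g k @[k --> \oo] --> 0.
Proof.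
move=> g0 gP tP dg dt.
have gp k : 0 < g k := lt_le_trans g0 (gP k).
have iP k : 0 <= (g k)^-1 <= gam0^-1.
  by rewrite invr_ge0 ltW//= lef_pV2 ?posrE.
pose c k := - ((1 - t k.+1) * ((g k)^-1 * (g k.+1)^-1)).
have -> : (fun k => (1 - t k.+1) / g k.+1 - (1 - t k) / g k) =
    (fun k => (g k.+1 - g k) * c k + (t k.+1 - t k) * - (g k)^-1).
  by apply/funext => k; rewrite /c; field; rewrite !gt_eqF.
rewrite -[X in _ --> X]addr0; apply: cvgD.
  apply: (@cvg0M_bounded _ _ _ _ _ c (gam0^-1 * gam0^-1) dg) => k.
  have /andP[t0 t1] := tP k.+1; have /andP[i0 i1] := iP k.
  have /andP[j0 j1] := iP k.+1.
  rewrite normrN normrM ger0_norm ?subr_ge0// ger0_norm ?mulr_ge0//.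
  rewrite -[leRHS]mul1r; apply: ler_pM; rewrite ?subr_ge0 ?mulr_ge0//.
    by rewrite lerBlDr lerDl.
  exact: ler_pM.
apply: (@cvg0M_bounded _ _ _ _ _ _ gam0^-1 dt) => k.
by have /andP[i0 i1] := iP k; rewrite normrN ger0_norm.
Qed.

(** In residual_cvg0_slow, wdz and wdd stand for <W d, z> and <W d, d>, dd for
    |d|^2, and AD for the squared norm of the new residual in the old metric.
    The gain is 2 / lam - 1, which is at least t0 / 2. *)
Lemma lyapunov_step_arith (lam lam0 t0 wdz wdd E A A' AD D dd mu : R) :
  0 < lam0 -> lam0 <= lam -> lam <= 2 - t0 -> 0 < mu -> 0 <= wdd -> 0 < t0 ->
  dd <= mu * wdd -> lam * wdz + wdd <= E ->
  A' = AD - D -> AD = A + 2 * wdz + wdd ->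
  A' + t0 / (2 * mu) * dd <= A + (2 / lam0 * `|E| + `|D|).
Proof.
move=> l0 ll lt m0 w0 tt0 hd hE -> ->.
have lam_gt0 : 0 < lam by lra.
have h1 : wdz <= lam^-1 * (E - wdd) by rewrite ler_pdivlMl//; lra.
have h2 : lam^-1 * E <= lam0^-1 * `|E|.
  apply: (@le_trans _ _ (lam^-1 * `|E|)).
    by rewrite ler_pM2l ?invr_gt0// ler_norm.
  by rewrite ler_wpM2r// lef_pV2 ?posrE.
have h3 : t0 / (2 * mu) * dd <= t0 / 2 * wdd.
  apply: (@le_trans _ _ (t0 / (2 * mu) * (mu * wdd))).
    by rewrite ler_wpM2l// divr_ge0 ?mulr_ge0 ?(ltW tt0) ?(ltW m0).
  rewrite le_eqVlt; apply/orP; left; apply/eqP; field; rewrite gt_eqF//.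
have h4 : (1 + t0 / 2) * wdd <= 2 * (lam^-1 * wdd).
  rewrite mulrA ler_wpM2r// ler_pdivlMr//.
  have : (1 + t0 / 2) * lam <= (1 + t0 / 2) * (2 - t0) by rewrite ler_wpM2l//; lra.
  by have := sqr_ge0 t0; rewrite expr2; lra.
have h5 := ler_norm (- D); rewrite normrN in h5.
move: h1; rewrite mulrBr => h1.
have -> : 2 / lam0 * `|E| = 2 * (lam0^-1 * `|E|) by rewrite mulrA.
move: h1 h2 h3 h4 h5.
move: (lam^-1 * E) (lam^-1 * wdd) (lam0^-1 * `|E|) (t0 / (2 * mu) * dd) => i1 i2 i3 i4.
rewrite mulrDl mul1r; move: (t0 / 2 * wdd) (`|D|) => i5 i6; clear; lra.
Qed.

Lemma cvg_finer {T : topologicalType} (G : set_system nat) (u : nat -> T) (l : T) :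
  \oo `<=` G -> u k @[k --> \oo] --> l -> u k @[k --> G] --> l.
Proof. by move=> sub ul N /ul; exact: sub. Qed.

Lemma norm_le_sqr (v K : R) : v ^+ 2 <= K -> v <= K + 1.
Proof. by move=> h; have := sqr_ge0 (v - 1); rewrite sqrrB; nra. Qed.

End arithmetic.

(** * The variable metric iteration *)
Section iteration.
Context {R : realType} {H : completeNormedModType R}.
Variable ip : {dot H for idfun}.
Hypothesis ip_norm : induces_norm ip.
Variable C : set H.
Hypotheses (C_nonempty : C !=set0) (C_closed : closed C).
Hypothesis C_convex : convex_set C.
Variable f : H -> R.
Hypothesis f_convex : convex_function [set: H] f.
Hypothesis f_diff : forall x, differentiable f x.
Variable L : R.
Hypotheses (L_gt0 : 0 < L) (f_lip : L.-lipschitz (gradient ip f)).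
Variable alpha : R.
Hypothesis alpha_gt0 : 0 < alpha.
Variable eta : nat -> R.
Hypotheses (eta_ge0 : forall k, 0 <= eta k) (eta_summable : summable_seq eta).
Variables U W : nat -> {linear H -> H}.
Hypothesis U_calP : forall k, calP ip alpha (U k).
Hypothesis U_monotone : forall k,
  loewner_ge ip (fun x => (1 + eta k) *: U k.+1 x) (U k).
Hypothesis invE : forall k, inv_op (U k) = W k.
Hypothesis UW : forall k x, U k (W k x) = x.
Variable mu : R.
Hypothesis U_gt0 : forall k, 0 < opnorm (U k).
Hypothesis U_le : forall k, opnorm (U k) <= mu.
Variables gamma lambda : nat -> R.
Hypothesis gamma_gt0 : forall k, 0 < gamma k.
Let theta k := gamma k * opnorm (U k) * L / 2.
Hypothesis theta_lt1 : forall k, theta k < 1.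
Hypothesis lambda_bounds : forall k, 0 < lambda k < 2 - theta k.
Variables a b x : nat -> H.
Hypothesis a_summable : summable_seq (fun k => lambda k * `|a k|).
Hypothesis b_summable : summable_seq (fun k => lambda k * `|b k|).
Local Notation B := (gradient ip f).
Hypothesis x_step : forall k, x k.+1 = x k + lambda k *:
  (inv_proj ip (U k) C (x k - gamma k *: U k (B (x k) + b k)) + a k - x k).
Local Notation Omega := (constrained_argmin f C).

Let p k := inv_proj ip (U k) C (x k - gamma k *: U k (B (x k))).
Let z k := x k - p k.
Let err k := x k.+1 - (x k - lambda k *: z k).
Let del k := lambda k * `|a k| + 2 / L * (lambda k * `|b k|).

Let lambda_gt0 k : 0 < lambda k. Proof. by case/andP: (lambda_bounds k). Qed.
Let theta_gt0 k : 0 < theta k.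
Proof. by rewrite /theta divr_gt0// !mulr_gt0. Qed.
Let W_ge0 k v : 0 <= ip (W k v) v.
Proof. exact: (inverse_ge0 ip_norm alpha_gt0 (U_calP k) (UW k) v). Qed.
Let mu_gt0 : 0 < mu. Proof. exact: lt_le_trans (U_gt0 0%N) (U_le 0%N). Qed.
Let W_coercive k v : `|v| ^+ 2 <= mu * ip (W k v) v.
Proof.
apply: (le_trans (sqnorm_le_inverse ip_norm alpha_gt0 (U_calP k) (UW k) v (U_gt0 k))).
exact: ler_wpM2r.
Qed.
Let W_le k v : ip (W k v) v <= alpha^-1 * `|v| ^+ 2.
Proof. exact: (inverse_le ip_norm alpha_gt0 (U_calP k) (UW k) v). Qed.
Let W_norm k v : `|W k v| <= alpha^-1 * `|v|.
Proof. exact: (inverse_norm_le ip_norm alpha_gt0 (U_calP k) (UW k) v). Qed.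
Let W_dec k v : ip (W k.+1 v) v <= (1 + eta k) * ip (W k v) v.
Proof.
exact: (inverse_loewner ip_norm alpha_gt0 (U_calP k) (U_calP k.+1)
  (eta_ge0 k) (U_monotone k) (UW k) (UW k.+1)).
Qed.
Let Wsa k : self_adjoint ip (W k).
Proof. exact (inverse_self_adjoint (U_calP k) (UW k)). Qed.

Lemma step_vi k : C (p k) /\ forall w, C w ->
  ip (W k (z k) - gamma k *: B (x k)) (w - p k) <= 0.
Proof.
have [Cp pP] := inv_projP ip_norm alpha_gt0 (U_calP k) (UW k) C_nonempty
  C_closed C_convex (U_gt0 k) (invE k) (x k - gamma k *: U k (B (x k))).
split => // w /pP; rewrite -/(p k).
suff -> : W k (x k - gamma k *: U k (B (x k)) - p k) =
  W k (z k) - gamma k *: B (x k) by [].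
rewrite addrAC (linearB (W k)) (linearZ_LR (W k)).
by rewrite (inverseK ip_norm (U_calP k) (UW k)).
Qed.

Lemma gammaU_le k : opnorm (U k) * gamma k <= 2 / L.
Proof.
rewrite ler_pdivlMr// [opnorm _ * _]mulrC; have := theta_lt1 k.
rewrite /theta; lra.
Qed.

(** The error b enters through U, which the metric of the projection cancels, so
    that its effect is controlled by |U_k| gamma_k < 2 / L. *)
Lemma err_le k : `|err k| <= del k.
Proof.
set Py := inv_proj ip (U k) C (x k - gamma k *: U k (B (x k) + b k)).
have -> : err k = lambda k *: (Py - p k + a k).
  rewrite /err x_step -/Py opprD opprK addrACA subrr add0r -scalerDr.
  by rewrite /z addrA subrK [Py + _ - _]addrAC.
rewrite normrZ gtr0_norm// /del mulrCA -mulrDr ler_pM2l//.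
apply: (le_trans (ler_normD _ _)); rewrite [leRHS]addrC; apply: lerD => //.
have pr h := inv_projP ip_norm alpha_gt0 (U_calP k) (UW k) C_nonempty
  C_closed C_convex (U_gt0 k) (invE k) h.
have [CP PP] := pr (x k - gamma k *: U k (B (x k) + b k)).
have [Cp pP] := pr (x k - gamma k *: U k (B (x k))).
have h : forall w, C w -> ip (W k (x k - gamma k *: U k (B (x k) + b k) +
    U k (gamma k *: b k) - p k)) (w - p k) <= 0.
  move=> w /pP; rewrite -/(p k) (linearD (U k)) (linearZ_LR (U k)).
  by rewrite scalerDr opprD addrA subrK.
apply: (le_trans (projection_perturbation ip_norm alpha_gt0 (U_calP k) (UW k)
  (U_gt0 k) CP Cp PP h)).
by rewrite normrZ gtr0_norm// mulrA ler_wpM2r// gammaU_le.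
Qed.

Lemma del_ge0 k : 0 <= del k. Proof. exact: le_trans (err_le k). Qed.

Lemma del_summable : summable_seq del.
Proof. exact (summableD a_summable (@summableZ _ (2 / L) _ b_summable)). Qed.

Lemma err_cvg0 : err k @[k --> \oo] --> (0 : H).
Proof. exact: (cvg_norm_le0 err_le (summable_cvg0 del_summable)). Qed.

(* slack is the decrease of xi that a step without error guarantees. *)
Let xi xs k := ip (W k (x k - xs)) (x k - xs).
Let s xs k := gamma k *: (B (x k) - B xs) - theta k *: W k (z k).
Let slack xs k := lambda k * (2 - theta k - lambda k) * ip (W k (z k)) (z k) +
  lambda k / theta k * (alpha * `|s xs k| ^+ 2).

(** The relaxation parameter lam is free: lambda_k gives the Fejer inequality and
    1 gives the boundedness of the projections p_k. *)
Lemma relaxed_step xs k lam : Omega xs -> 0 <= lam ->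
  ip (W k (x k - lam *: z k - xs)) (x k - lam *: z k - xs) <=
  xi xs k - lam * (2 - theta k - lam) * ip (W k (z k)) (z k)
    - lam / theta k * (alpha * `|s xs k| ^+ 2).
Proof.
move=> xsO lam0; have [Cp pP] := step_vi k.
exact: (forward_backward_step ip_norm (U_calP k) (UW k) (U_gt0 k) erefl
  (gamma_gt0 k) L_gt0 lam0 (pP _ xsO.1) (optimality ip_norm f_diff C_convex xsO Cp)
  (cocoercive ip_norm f_diff f_convex L_gt0 f_lip _ _)).
Qed.

Lemma slack_ge0 xs k : 0 <= slack xs k.
Proof.
have /andP[l0 l1] := lambda_bounds k.
rewrite addr_ge0// mulr_ge0//; first by rewrite mulr_ge0 ?ltW//; lra.
  by rewrite divr_ge0 ?ltW.
by rewrite mulr_ge0 ?sqr_ge0// ltW.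
Qed.

Lemma fejer xs : Omega xs ->
  cvgn (xi xs) /\ slack xs k @[k --> \oo] --> 0.
Proof.
move=> xsO.
have [E E0 etaE] := summable_bounded eta_ge0 eta_summable.
have [D D0 delD] := summable_bounded del_ge0 del_summable.
pose e k := eta k + (1 + E) * del k.
pose d k := (1 + E) * (alpha^-1 * (1 + D)) * del k.
have ia0 : 0 < alpha^-1 by rewrite invr_gt0.
have E1 : 0 < 1 + E by lra.
have D1 : 0 < 1 + D by lra.
apply: (@quasi_fejer _ (xi xs) (slack xs) e d).
- by move=> k; exact: W_ge0.
- exact: slack_ge0.
- by move=> k; rewrite addr_ge0// mulr_ge0 ?del_ge0// ltW.
- by move=> k; rewrite !mulr_ge0 ?del_ge0// ltW.
- exact (summableD eta_summable (@summableZ _ (1 + E) _ del_summable)).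
- exact (@summableZ _ ((1 + E) * (alpha^-1 * (1 + D))) _ del_summable).
move=> k; pose u := x k - lambda k *: z k - xs; pose N := ip (W k u) u.
have h1 : N <= xi xs k - slack xs k.
  by rewrite /slack opprD addrA; exact: (relaxed_step k xsO (ltW (lambda_gt0 k))).
have h2 : ip (W k (x k.+1 - xs)) (x k.+1 - xs) <=
    (1 + del k) * N + alpha^-1 * (del k + del k ^+ 2).
  have -> : x k.+1 - xs = u + err k.
    by rewrite /err [RHS]addrC addrA subrK.
  exact (quad_perturbation ip_norm alpha_gt0 (U_calP k) (UW k) _ (err_le k)).
have h3 := W_dec k (x k.+1 - xs); rewrite -/(xi xs k.+1) in h3.
have N0 : 0 <= N by exact: W_ge0.
exact: (fejer_arith N0 (slack_ge0 xs k) (eta_ge0 k) (etaE k) (del_ge0 k)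
  (delD k) ia0 h1 h2 h3).
Qed.

Lemma iterates_bounded xs : Omega xs -> exists M,
  (forall k, `|x k - xs| <= M) /\ forall k, `|z k| <= M.
Proof.
move=> xsO; have [/cvg_bounded[X xiX] _] := fejer xsO.
have X0 : 0 <= X := le_trans (normr_ge0 _) (xiX 0%N).
have small k v : ip (W k v) v <= xi xs k -> `|v| <= mu * X + 1.
  move=> h; apply: norm_le_sqr; apply: (le_trans (W_coercive k v)).
  by rewrite ler_pM2l// (le_trans h)// (le_trans (ler_norm _) (xiX k)).
have pM k : `|p k - xs| <= mu * X + 1.
  apply: (small k); have := relaxed_step k xsO ler01.
  have -> : x k - 1 *: z k = p k by rewrite scale1r /z subKr.
  move=> /le_trans; apply.
  have := theta_lt1 k; have := theta_gt0 k => t0 t1.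
  rewrite -addrA -opprD gerBl addr_ge0// mulr_ge0//.
    by rewrite mul1r; lra.
    by rewrite mul1r invr_ge0 ltW.
  by rewrite mulr_ge0 ?sqr_ge0// ltW.
have xM k : `|x k - xs| <= mu * X + 1 by exact: (small k).
have m0 : 0 <= mu * X + 1 by rewrite addr_ge0// mulr_ge0// ltW.
exists (2 * (mu * X + 1)); split => k; first by have := xM k; lra.
have -> : z k = (x k - xs) - (p k - xs) by rewrite /z opprB addrA subrK.
by apply: (le_trans (ler_normB _ _)); have := xM k; have := pM k; lra.
Qed.

Lemma forward_residual_cvg0 xs lam0 : Omega xs -> 0 < lam0 ->
  (forall k, lam0 <= lambda k) -> s xs k @[k --> \oo] --> (0 : H).
Proof.
move=> xsO l0 lamP; have [_ sl0] := fejer xsO.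
apply: cvg_sqr0.
have c0 : 0 < lam0 * alpha by rewrite mulr_gt0.
apply: (@cvg_norm_le0 _ _ _ _ _ _ (fun k => (lam0 * alpha)^-1 * slack xs k)).
  move=> k; rewrite normrX normr_id ler_pdivlMl// /slack.
  have /andP[l1 l2] := lambda_bounds k.
  have h1 : 0 <= lambda k * (2 - theta k - lambda k) * ip (W k (z k)) (z k).
    by rewrite mulr_ge0 ?W_ge0// mulr_ge0 ?ltW//; lra.
  have h2 : lam0 * (alpha * `|s xs k| ^+ 2) <=
      lambda k / theta k * (alpha * `|s xs k| ^+ 2).
    apply: ler_wpM2r; first by rewrite mulr_ge0 ?sqr_ge0// ltW.
    rewrite ler_pdivlMr ?theta_gt0//; apply: le_trans (lamP k).
    by rewrite ler_piMr ?(ltW l0)// ltW.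
  by rewrite -mulrA; lra.
rewrite -[X in _ --> X](mulr0 (lam0 * alpha)^-1).
by apply: cvgM => //; exact: cvg_cst.
Qed.

(** The first term of the slack alone controls the residual. *)
Lemma residual_cvg0_relaxed xs c : Omega xs -> 0 < c ->
  (forall k, c <= lambda k * (2 - theta k - lambda k)) ->
  z k @[k --> \oo] --> (0 : H).
Proof.
move=> xsO c0 cP; have [_ sl0] := fejer xsO.
apply: cvg_sqr0.
apply: (@cvg_norm_le0 _ _ _ _ _ _ (fun k => mu / c * slack xs k)).
  move=> k; rewrite normrX normr_id; apply: (le_trans (W_coercive _ _)).
  rewrite -mulrA ler_pM2l// ler_pdivlMl// /slack.
  have h1 : 0 <= lambda k / theta k * (alpha * `|s xs k| ^+ 2).
    apply: mulr_ge0; first by apply: divr_ge0; exact: ltW.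
    by rewrite mulr_ge0 ?sqr_ge0// ltW.
  have h2 := ler_wpM2r (W_ge0 k (z k)) (cP k).
  by lra.
rewrite -[X in _ --> X](mulr0 (mu / c)).
by apply: cvgM => //; exact: cvg_cst.
Qed.

Lemma gradient_cvg xs lam0 gam0 : Omega xs -> 0 < lam0 ->
  (forall k, lam0 <= lambda k) -> 0 < gam0 -> (forall k, gam0 <= gamma k) ->
  z k @[k --> \oo] --> (0 : H) -> B (x k) @[k --> \oo] --> B xs.
Proof.
move=> xsO l0 lamP g0 gamP z0; have s0 := forward_residual_cvg0 xsO l0 lamP.
apply: (@cvg_dist_le _ _ _ _ _ _ _
  (fun k => gam0^-1 * (`|s xs k| + alpha^-1 * `|z k|))).
  apply: nearW => k.
  have -> : B (x k) - B xs = (gamma k)^-1 *: (s xs k + theta k *: W k (z k)).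
    by rewrite /s subrK scalerA mulVf ?scale1r// gt_eqF.
  rewrite normrZ gtr0_norm ?invr_gt0//; apply: ler_pM => //.
  - by rewrite invr_ge0 ltW.
  - by rewrite lef_pV2 ?posrE.
  apply: (le_trans (ler_normD _ _)); rewrite lerD2l normrZ gtr0_norm//.
  rewrite -[leRHS]mul1r; apply: ler_pM => //; first exact: ltW.
  exact: ltW.
have -> : 0 = gam0^-1 * (`|0 : H| + alpha^-1 * `|0 : H|).
  by rewrite normr0 mulr0 addr0 mulr0.
apply: cvgM; first exact: cvg_cst.
by apply: cvgD; [exact: cvg_norm|apply: cvgM; [exact: cvg_cst|exact: cvg_norm]].
Qed.

Lemma gamma_le k : gamma k <= 2 / L / alpha.
Proof.
rewrite ler_pdivlMr// mulrC; apply: le_trans (gammaU_le k).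
by rewrite ler_pM2r// (alpha_le_opnorm ip_norm (U_calP k) (U_gt0 k)).
Qed.

(** No lower bound is available for the relaxation margin 2 - theta - lambda.
    The vectors m_k = W_k z_k / gamma_k - B x_k are normal to C at p_k.  Because the
    forward residual vanishes, m_k = rho_k W_k z_k - B xs + o(1) with
    rho_k = (1 - theta_k) / gamma_k > 0, and rho and W vary slowly, so that
    monotonicity of the normal cone reads
    0 <= <W_k d, p_{k+1} - p_k> + o(1) with d = z_{k+1} - z_k.  As
    p_{k+1} - p_k = - lambda_k z_k - d + o(1), this bounds 2 <W_k d, z_k> above by
    - (2 / lambda_k) N_k(d)^2 + o(1), hence N_k(z_k)^2 decreases by
    (2 / lambda_k - 1) N_k(d)^2 up to o(1), as lyapunov_vanish requires. *)
Lemma residual_cvg0_slow xs lam0 gam0 e0 : Omega xs -> 0 < lam0 ->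
  (forall k, lam0 <= lambda k) -> 0 < gam0 -> (forall k, gam0 <= gamma k) ->
  0 < e0 -> (forall k, theta k <= 1 - e0) ->
  gamma k.+1 - gamma k @[k --> \oo] --> 0 ->
  theta k.+1 - theta k @[k --> \oo] --> 0 ->
  (forall (v : nat -> H) M, (forall k, `|v k| <= M) ->
     W k (v k) - W k.+1 (v k) @[k --> \oo] --> (0 : H)) ->
  z k @[k --> \oo] --> (0 : H).
Proof.
move=> xsO l0 lamP g0 gamP e00 thP dgam dth dW.
have s0 := forward_residual_cvg0 xsO l0 lamP.
have [M [xM zM]] := iterates_bounded xsO.
have M0 : 0 <= M := le_trans (normr_ge0 _) (zM 0%N).
have t01 k : 0 <= theta k <= 1 by rewrite !ltW.
pose rho k := (1 - theta k) / gamma k.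
have rho_gt0 k : 0 < rho k by rewrite divr_gt0// subr_gt0.
have drho : rho k.+1 - rho k @[k --> \oo] --> 0.
  exact: (ratio_variation_cvg0 g0 gamP t01 dgam dth).
have irho k : `|(rho k)^-1| <= 2 / L / alpha / e0.
  rewrite gtr0_norm ?invr_gt0// /rho invf_div; apply: ler_pM; rewrite ?gamma_le//.
  - exact: ltW.
  - by rewrite invr_ge0 subr_ge0 ltW.
  - by rewrite lef_pV2 ?posrE ?subr_gt0//; have := thP k; lra.
have igam k : `|(gamma k)^-1| <= gam0^-1.
  by rewrite gtr0_norm ?invr_gt0// lef_pV2 ?posrE.
pose sigma k := (gamma k)^-1 *: s xs k.
have sigma0 : sigma k @[k --> \oo] --> (0 : H) by exact: scale_cvg0 igam s0.
pose w k := W k (z k).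
have wM k : `|w k| <= alpha^-1 * M.
  by apply: (le_trans (W_norm _ _)); rewrite ler_pM2l ?invr_gt0.
pose D k := W k (z k.+1) - W k.+1 (z k.+1).
have D0 : D k @[k --> \oo] --> (0 : H) by apply: (dW _ M) => k; exact: zM.
pose d k := z k.+1 - z k.
pose q k := p k.+1 - p k.
pose m k := (gamma k)^-1 *: w k - B (x k).
have mE k : m k = rho k *: w k - sigma k - B xs.
  by rewrite /m /sigma /s /rho; apply: normal_vector_identity; rewrite gt_eqF.
have mG k : gamma k *: m k = w k - gamma k *: B (x k).
  by rewrite /m scalerBr scalerA mulfV ?gt_eqF// scale1r.
pose r k := (rho k)^-1 *: ((rho k.+1 - rho k) *: w k.+1 - (sigma k.+1 - sigma k))
  - D k.
have r0 : r k @[k --> \oo] --> (0 : H).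
  apply: cvg0B => //; apply: (scale_cvg0 irho); apply: cvg0B.
    by apply: scale0_cvg0 drho _ => k; exact: wM.
  exact: (cvg0B (cvg0S sigma0) sigma0).
have mono k : 0 <= ip (W k (d k) + r k) (q k).
  rewrite -(pmulr_rge0 _ (rho_gt0 k)) -ipZl.
  have -> : rho k *: (W k (d k) + r k) = m k.+1 - m k.
    have e1 : W k (d k) = w k.+1 + D k - w k.
      by rewrite [w k.+1 + D k]addrC [D k + _]subrK (linearB (W k)).
    rewrite (mE k) (mE k.+1) e1; apply: variation_identity.
    by rewrite gt_eqF.
  have [Cp pP] := step_vi k; have [Cp' pP'] := step_vi k.+1.
  have m1 : ip (m k) (q k) <= 0.
    rewrite -(pmulr_rle0 _ (gamma_gt0 k)) -ipZl mG.
    exact: (pP _ Cp').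
  have m2 : ip (m k.+1) (p k - p k.+1) <= 0.
    rewrite -(pmulr_rle0 _ (gamma_gt0 k.+1)) -ipZl mG.
    exact: (pP' _ Cp).
  have e : p k - p k.+1 = - q k by rewrite opprB.
  rewrite e ipNr oppr_le0 in m2; rewrite ipBl subr_ge0.
  exact: le_trans m1 m2.
have qE k : q k = err k - lambda k *: z k - d k.
  exact: relaxation_identity.
have qM k : `|q k| <= 4 * M.
  have pM j : `|p j - xs| <= 2 * M.
    have -> : p j - xs = (x j - xs) - z j.
      by rewrite /z [RHS]addrAC subKr.
    by apply: (le_trans (ler_normB _ _)); have := xM j; have := zM j; lra.
  have -> : q k = (p k.+1 - xs) - (p k - xs) by rewrite opprB addrA subrK.
  have -> : 4 * M = 2 * M + 2 * M by ring.
  exact: le_trans (ler_normB _ _) (lerD (pM k.+1) (pM k)).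
pose E k := ip (r k) (q k) + ip (W k (d k)) (err k).
have E0 : E k @[k --> \oo] --> 0.
  rewrite -[X in _ --> X]addr0; apply: cvgD.
    exact: (ip_cvg0 ip_norm r0 qM).
  have -> : (fun k => ip (W k (d k)) (err k)) = (fun k => ip (err k) (W k (d k))).
    by apply/funext => k; rewrite ipC.
  apply: (ip_cvg0 ip_norm err_cvg0 (M := alpha^-1 * (2 * M))) => k.
  apply: (le_trans (W_norm _ _)); rewrite ler_pM2l ?invr_gt0//.
  have -> : 2 * M = M + M by ring.
  exact: le_trans (ler_normB _ _) (lerD (zM k.+1) (zM k)).
pose A k := ip (W k (z k)) (z k).
pose t0 := gam0 * alpha * L / 2.
have t00 : 0 < t0 by rewrite divr_gt0// !mulr_gt0.
have t0P k : t0 <= theta k.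
  rewrite /t0 /theta ler_pM2r ?invr_gt0// ler_pM2r//; apply: ler_pM => //.
  - exact: ltW.
  - exact: ltW.
  - exact: (alpha_le_opnorm ip_norm (U_calP k) (U_gt0 k)).
pose en k := 2 / lam0 * `|E k| + `|ip (D k) (z k.+1)|.
have en0 : en k @[k --> \oo] --> 0.
  have -> : 0 = 2 / lam0 * `|0 : R| + `|0 : R| by rewrite normr0 mulr0 addr0.
  apply: cvgD; first by apply: cvgM; [exact: cvg_cst|exact: cvg_norm].
  exact: (cvg_norm (ip_cvg0 ip_norm D0 (fun k => zM k.+1))).
have step k : A k.+1 + t0 / (2 * mu) * `|z k.+1 - z k| ^+ 2 <= A k + en k.
  have /andP[l1 l2] := lambda_bounds k.
  have h1 : lambda k <= 2 - t0 by have := t0P k; lra.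
  have h2 : lambda k * ip (W k (d k)) (z k) + ip (W k (d k)) (d k) <= E k.
    have h := mono k; rewrite ipDl addrC in h.
    have e : ip (W k (d k)) (q k) = ip (W k (d k)) (err k) -
      lambda k * ip (W k (d k)) (z k) - ip (W k (d k)) (d k).
      rewrite (qE k) (ipBr ip _ (d k)) (ipBr ip (err k)) ipZr.
      exact: erefl.
    by rewrite e in h; rewrite /E; lra.
  have h3 : A k.+1 = ip (W k (z k.+1)) (z k.+1) - ip (D k) (z k.+1).
    by rewrite /D ipBl subKr.
  have h4 : ip (W k (z k.+1)) (z k.+1) =
      A k + 2 * ip (W k (d k)) (z k) + ip (W k (d k)) (d k).
    have -> : z k.+1 = z k + d k by rewrite addrC subrK.
    by rewrite quadD//; congr (_ + _ * _ + _); rewrite Wsa ipC.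
  exact: (lyapunov_step_arith l0 (lamP k) h1 mu_gt0 (W_ge0 k (d k)) t00
    (W_coercive k (d k)) h2 h3 h4).
have A0 : A k @[k --> \oo] --> 0.
  have ia0 : 0 < alpha^-1 by rewrite invr_gt0.
  have c0 : 0 < t0 / (2 * mu) by rewrite divr_gt0// mulr_gt0.
  have AP k : 0 <= A k <= alpha^-1 * `|z k| ^+ 2.
    by apply/andP; split; [exact: W_ge0 | exact: W_le].
  have lP k : lam0 <= lambda k <= 2.
    by have /andP[l1 l2] := lambda_bounds k; have := theta_gt0 k;
      rewrite lamP/=; lra.
  have xS k : x k.+1 - xs = x k - xs - lambda k *: z k + err k.
    by rewrite /err [RHS]addrC [x k - xs - _]addrAC addrA subrK.
  exact: (lyapunov_vanish ip_norm ia0 c0 l0 xM zM AP lP step xS en0 err_cvg0).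
apply: cvg_sqr0; apply: (@cvg_norm_le0 _ _ _ _ _ _ (fun k => mu * A k)).
  by move=> k; rewrite normrX normr_id; exact: W_coercive.
rewrite -[X in _ --> X](mulr0 mu).
exact: (cvgM (cvg_cst mu) A0).
Qed.

(** The projections p_k have the same weak limit as x_k, and it lies in C because
    C is convex and closed.  Passing to the limit in the variational inequality,
    where B x_k - W_k z_k / gamma_k converges strongly, gives
    <B xs, w - pb> >= 0 on C.  Cocoercivity between x_k and pb identifies B pb with
    the strong limit B xs, so that the inequality is the optimality condition at
    pb. *)
Lemma cluster_optimal xs gam0 (G : set_system nat) pb :
  Omega xs -> 0 < gam0 -> (forall k, gam0 <= gamma k) ->
  z k @[k --> \oo] --> (0 : H) -> B (x k) @[k --> \oo] --> B xs ->
  UltraFilter G -> \oo `<=` G ->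
  (forall v, ip (x k) v @[k --> G] --> ip pb v) -> Omega pb.
Proof.
move=> xsO g0 gamP z0 Bx GU sub xpb.
have GP : ProperFilter G := @ultra_proper _ _ GU.
have [M [xM zM]] := iterates_bounded xsO.
have zG := cvg_finer sub z0; have BG := cvg_finer sub Bx.
have pw v : ip (p k) v @[k --> G] --> ip pb v.
  have -> : (fun k => ip (p k) v) = (fun k => ip (x k) v - ip (z k) v).
    by apply/funext => k; rewrite -ipBl /z subKr.
  rewrite -[X in _ --> X]subr0; apply: cvgB; first exact: xpb.
  by rewrite -(ip0l ip v); exact: (ip_cvg ip_norm zG (cvg_cst v)).
have pM k : `|p k| <= `|xs| + 2 * M.
  have -> : p k = xs + (x k - xs - z k).
    by rewrite /z [x k - xs - _]addrAC subKr [RHS]addrC subrK.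
  apply: (le_trans (ler_normD _ _)); rewrite lerD2l.
  have -> : 2 * M = M + M by ring.
  exact: le_trans (ler_normB _ _) (lerD (xM k) (zM k)).
have Cpb : C pb.
  (* The solution q of the variational inequality for the identity operator is
     the orthogonal projection of pb onto C. *)
  have idP : calP ip 1 (idfun : {linear H -> H}).
    by split => //; [exists 1 => v; rewrite mul1r | move=> v /=; rewrite scale1r].
  have [||q Cq qP] := @stampacchia _ _ _ ip_norm _ _ C (ip pb) `|pb|
    ltr01 idP C_closed C_convex C_nonempty.
  - by move=> c u v; rewrite ipDr ipZr.
  - by move=> v; exact: ip_le_norm.
  suff -> : pb = q by [].
  apply/eqP; rewrite -subr_eq0 -normr_eq0 -sqrf_eq0 eq_le sqr_ge0 andbT.
  rewrite (sqnormE ip_norm) ipBr.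
  have lim1 : ip (p k) (pb - q) @[k --> G] --> ip pb (pb - q) := pw _.
  rewrite subr_le0 [leLHS]ipC [leRHS]ipC.
  apply: (ler_cvg_to lim1 (cvg_cst _)); apply: nearW => k.
  have [Cp _] := step_vi k; have := qP _ Cp.
  rewrite /= !ipBr (ipC ip pb q) (ipC ip (p k)) (ipC ip (p k)) => h; lra.
have opt w : C w -> 0 <= ip (B xs) (w - pb).
  move=> Cw; pose V k := B (x k) - (gamma k)^-1 *: W k (z k).
  have V_cvg : V k @[k --> G] --> B xs.
    apply: (cvg_finer sub); rewrite -[X in _ --> X]subr0; apply: cvgB => //.
    apply: (@scale_cvg0 _ _ _ _ gam0^-1) => [k|].
      by rewrite gtr0_norm ?invr_gt0// lef_pV2 ?posrE.
    apply: (@cvg_norm_le0 _ _ _ _ _ _ (fun k => alpha^-1 * `|z k|)).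
      by move=> k; exact: W_norm.
    have -> : 0 = alpha^-1 * `|0 : H| by rewrite normr0 mulr0.
    by apply: cvgM; [exact: cvg_cst | exact: cvg_norm].
  have wpM k : `|w - p k| <= `|w| + (`|xs| + 2 * M).
    exact: le_trans (ler_normB _ _) (lerD (lexx _) (pM k)).
  have wpw v : ip (w - p k) v @[k --> G] --> ip (w - pb) v.
    have -> : (fun k => ip (w - p k) v) = (fun k => ip w v - ip (p k) v).
      by apply/funext => k; rewrite ipBl.
    by rewrite ipBl; apply: cvgB; [exact: cvg_cst | exact: pw].
  have lim : ip (w - p k) (V k) @[k --> G] --> ip (w - pb) (B xs).
    exact: (ip_cvg_weak ip_norm wpM wpw V_cvg).
  rewrite ipC; apply: (ler_cvg_to (cvg_cst _) lim); apply: nearW => k.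
  have [_ /(_ _ Cw)] := step_vi k; rewrite ipC => h.
  rewrite -(pmulr_rge0 _ (gamma_gt0 k)) -ipZr /V scalerBr scalerA.
  by rewrite mulfV ?gt_eqF// scale1r -oppr_le0 -ipNr opprB.
have Bpb : B pb = B xs.
  have lim1 : ip (x k - pb) (B (x k) - B pb) @[k --> G] -->
      ip (0 : H) (B xs - B pb).
    apply: (@ip_cvg_weak _ _ _ ip_norm _ _ _ _ _ _ _ (M + `|xs - pb|)).
    - move=> k; have -> : x k - pb = (x k - xs) + (xs - pb).
        by rewrite addrA subrK.
      by apply: (le_trans (ler_normD _ _)); rewrite lerD2r.
    - move=> v; rewrite ip0l.
      have -> : (fun k => ip (x k - pb) v) = (fun k => ip (x k) v - ip pb v).
        by apply/funext => k; rewrite ipBl.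
      by rewrite -[X in _ --> X](subrr (ip pb v)); apply: cvgB;
        [exact: xpb | exact: cvg_cst].
    - by apply: cvgB; [exact: BG | exact: cvg_cst].
  have dB : B (x k) - B pb @[k --> G] --> B xs - B pb.
    by apply: cvgB; [exact: BG | exact: cvg_cst].
  have lim2 : ip (B (x k) - B pb) (B (x k) - B pb) @[k --> G] -->
      ip (B xs - B pb) (B xs - B pb) by exact: (ip_cvg ip_norm dB dB).
  apply/eqP; rewrite eq_sym -subr_eq0 -normr_eq0 -sqrf_eq0 eq_le sqr_ge0 andbT.
  rewrite (sqnormE ip_norm).
  have lim3 : L * ip (x k - pb) (B (x k) - B pb) @[k --> G] --> 0.
    rewrite -[X in _ --> X](mulr0 L) -(ip0l ip (B xs - B pb)).
    by apply: cvgM; [exact: cvg_cst | exact: lim1].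
  apply: (ler_cvg_to lim2 lim3); apply: nearW => k.
  rewrite -(sqnormE ip_norm) -ler_pdivrMl// [leRHS]ipC.
  exact: (cocoercive ip_norm f_diff f_convex L_gt0 f_lip).
split; first exact: Cpb.
move=> w Cw; apply: le_trans (gradient_ineq ip_norm f_diff f_convex pb w).
by rewrite lerDl Bpb; exact: opt.
Qed.

(** Opial's argument in a variable metric: the difference of the two convergent
    sequences N_k(x_k - p1)^2 and N_k(x_k - p2)^2 shows that
    <x_k, W_k (p1 - p2)> converges.  As W_k (p1 - p2) converges strongly to some w,
    its limits <p1, w> and <p2, w> along the two ultrafilters agree, and
    <p1 - p2, w> dominates |p1 - p2|^2 / mu. *)
Lemma cluster_unique (G1 G2 : set_system nat) p1 p2 :
  Omega p1 -> Omega p2 -> UltraFilter G1 -> UltraFilter G2 ->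
  \oo `<=` G1 -> \oo `<=` G2 ->
  (forall v, ip (x k) v @[k --> G1] --> ip p1 v) ->
  (forall v, ip (x k) v @[k --> G2] --> ip p2 v) -> p1 = p2.
Proof.
move=> p1O p2O GU1 GU2 sub1 sub2 xp1 xp2.
have GP1 : ProperFilter G1 := @ultra_proper _ _ GU1.
have GP2 : ProperFilter G2 := @ultra_proper _ _ GU2.
have [M [xM _]] := iterates_bounded p1O.
have xM' k : `|x k| <= M + `|p1|.
  have -> : x k = (x k - p1) + p1 by rewrite subrK.
  by apply: (le_trans (ler_normD _ _)); rewrite lerD2r.
have ia0 : 0 < alpha^-1 by rewrite invr_gt0.
have Wb k v : 0 <= ip (W k v) v <= alpha^-1 * `|v| ^+ 2.
  by apply/andP; split; [exact: W_ge0 | exact: W_le].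
have Wcvg v : cvgn (fun k => W k v).
  exact: (almost_decreasing_cvg ip_norm ia0 Wsa Wb eta_ge0 eta_summable W_dec).
pose w := limn (fun k => W k (p1 - p2)).
have Ww : W k (p1 - p2) @[k --> \oo] --> w := Wcvg _.
have Wq v : cvgn (fun k => ip (W k v) v).
  apply/cvg_ex; exists (ip (limn (fun k => W k v)) v).
  exact: (ip_cvg ip_norm (Wcvg v) (cvg_cst v)).
have [c1 _] := fejer p1O; have [c2 _] := fejer p2O.
have xW : cvgn (fun k => ip (x k) (W k (p1 - p2))).
  have -> : (fun k => ip (x k) (W k (p1 - p2))) = (fun k => 2^-1 *
      (xi p2 k - xi p1 k + (ip (W k p1) p1 - ip (W k p2) p2))).
    apply/funext => k; rewrite /xi !quadB//.
    have -> : ip (x k) (W k (p1 - p2)) = ip (W k (x k)) p1 - ip (W k (x k)) p2.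
      by rewrite -Wsa ipBr.
    move: (ip _ _) (ip _ _) (ip _ _) (ip _ _) (ip _ _) => *; lra.
  apply: is_cvgM; first exact: is_cvg_cst.
  by apply: is_cvgD; apply: is_cvgB.
have e1 := cvg_finer sub1 xW; have e2 := cvg_finer sub2 xW.
have l1 : ip (x k) (W k (p1 - p2)) @[k --> G1] --> ip p1 w.
  exact: (ip_cvg_weak ip_norm xM' xp1 (cvg_finer sub1 Ww)).
have l2 : ip (x k) (W k (p1 - p2)) @[k --> G2] --> ip p2 w.
  exact: (ip_cvg_weak ip_norm xM' xp2 (cvg_finer sub2 Ww)).
have e : ip p1 w = ip p2 w.
  rewrite -(cvg_lim (@norm_hausdorff _ R) l1) -(cvg_lim (@norm_hausdorff _ R) l2).
  by rewrite (cvg_lim (@norm_hausdorff _ R) e1) (cvg_lim (@norm_hausdorff _ R) e2).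
apply/eqP; rewrite -subr_eq0 -normr_eq0 -sqrf_eq0 eq_le sqr_ge0 andbT.
have lim : mu * ip (W k (p1 - p2)) (p1 - p2) @[k --> \oo] --> 0.
  have -> : 0 = mu * ip w (p1 - p2).
    by rewrite ipC ipBl e subrr mulr0.
  apply: cvgM; first exact: cvg_cst.
  exact: (ip_cvg ip_norm Ww (cvg_cst _)).
by apply: (ler_cvg_to (cvg_cst _) lim); apply: nearW => k; exact: W_coercive.
Qed.

Lemma weak_convergence xs gam0 : Omega xs -> 0 < gam0 ->
  (forall k, gam0 <= gamma k) ->
  z k @[k --> \oo] --> (0 : H) -> B (x k) @[k --> \oo] --> B xs ->
  exists2 xbar, Omega xbar & weak_cvg ip x xbar.
Proof.
move=> xsO g0 gamP z0 Bx; have [M [xM _]] := iterates_bounded xsO.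
have xM' k : `|x k| <= M + `|xs|.
  have -> : x k = (x k - xs) + xs by rewrite subrK.
  by apply: (le_trans (ler_normD _ _)); rewrite lerD2r.
have lim G : UltraFilter G -> \oo `<=` G ->
    exists2 pb, Omega pb & forall v, ip (x k) v @[k --> G] --> ip pb v.
  move=> GU sub; have [pb pbP] := ultra_weak_limit ip_norm GU xM'.
  exists pb => //; exact: (cluster_optimal xsO g0 gamP z0 Bx GU sub pbP).
have [G0 [GU0 sub0]] := ultraFilterLemma (@eventually_filter).
have [xbar xO xbarP] := lim G0 GU0 sub0.
exists xbar => // v; apply: cvg_ultra => G GU sub.
have [pb pbO pbP] := lim G GU sub.
by rewrite (cluster_unique xO pbO GU0 GU sub0 sub xbarP pbP); exact: pbP.
Qed.

End iteration.

(** * Convergence theorem *)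
Section parameter_arithmetic.
Context {R : realType}.

Lemma relaxation_bound (n g L : R) : 0 < L -> g < 2 * L^-1 / n -> 0 < n ->
  g * n * L / 2 < 1 /\
  1 / (2 * L^-1 / (4 * L^-1 - g * n)) = 2 - g * n * L / 2.
Proof.
move=> L0 gn n0; rewrite ltr_pdivlMr// in gn.
have h : g * n * L < 2 by rewrite -ltr_pdivlMr.
split; first lra.
have d0 : 4 * L^-1 - g * n != 0.
  rewrite gt_eqF//; have : 0 < L^-1 by rewrite invr_gt0.
  by move: (L^-1) gn => l; lra.
rewrite mul1r invf_div; field; rewrite gt_eqF//.
Qed.

Lemma theta_bound (n g L mu e : R) : 0 < L -> n <= mu -> 0 < mu -> 0 < g ->
  g <= (2 * L^-1 - e) / mu -> g * n * L / 2 <= 1 - e * L / 2.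
Proof.
move=> L0 nmu mu0 g0; rewrite ler_pdivlMr// => h.
have h1 : g * n <= 2 * L^-1 - e by apply: le_trans h; rewrite ler_pM2l.
have : g * n * L <= (2 * L^-1 - e) * L by rewrite ler_pM2r.
by rewrite mulrBl mulfVK ?gt_eqF//; lra.
Qed.

End parameter_arithmetic.

Theorem theorem4p2 (R : realType) (H : completeNormedModType R)
  (ip : {dot H for idfun}) (ip_norm : induces_norm ip)
  (C : set H) (C_nonempty : C !=set0) (C_closed : closed C)
  (C_convex : convex_set C)
  (f : H -> R) (f_proper : proper_function (EFin \o f))
  (f_closed : lower_semicontinuous (EFin \o f))
  (f_convex : convex_function [set: H] f)
  (f_diff : forall x, differentiable f x)
  (L : R) (L_gt0 : 0 < L) (f_lip : L.-lipschitz (gradient ip f))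
  (beta := L^-1)
  (Omega := constrained_argmin f C) (Omega_nonempty : Omega !=set0)
  (alpha : R) (alpha_gt0 : 0 < alpha)
  (eta : nat -> R) (eta_ge0 : forall k, 0 <= eta k)
  (eta_summable : summable_seq eta)
  (U : nat -> {linear H -> H}) (U_calP : forall k, calP ip alpha (U k))
  (U_bounded : has_ubound (range (fun k => opnorm (U k))))
  (mu := sup (range (fun k => opnorm (U k))))
  (U_monotone : forall k,
     loewner_ge ip (fun x => (1 + eta k) *: U k.+1 x) (U k))
  (gamma lambda : nat -> R)
  (gamma_bounds : forall k, 0 < gamma k < 2 * beta / opnorm (U k))
  (alpha_ := fun k => 2 * beta / (4 * beta - gamma k * opnorm (U k)))
  (lambda_bounds : forall k, 0 < lambda k < 1 / alpha_ k)
  (a b : nat -> H)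
  (a_summable : summable_seq (fun k => lambda k * `|a k|))
  (b_summable : summable_seq (fun k => lambda k * `|b k|))
  (AB :
    (* (A) *)
    (exists lambda0 tau gamma0 epsilon : R,
      [/\ 0 < lambda0,
          forall k, lambda0 <= lambda k <= 1 / alpha_ k - tau,
          forall k, 0 < tau < 1 / alpha_ k - lambda0 &
      [/\ 0 < gamma0,
          forall k, gamma0 <= gamma k <= (2 * beta - epsilon) / mu &
          0 < epsilon < 2 * beta - mu * gamma0]])
    \/
    (* (B) *)
    (exists lambda0 gamma0 epsilon : R,
      [/\ series (fun k => lambda k * (1 / alpha_ k - lambda k)) @ \oo --> +oo,
      [/\ 0 < gamma0,
          forall k, gamma0 <= gamma k <= (2 * beta - epsilon) / mu &
          0 < epsilon < 2 * beta - mu * gamma0],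
      [/\ summable_seq (fun k => `|gamma k.+1 - gamma k|),
          summable_seq (fun k =>
            `|gamma k.+1 * opnorm (U k.+1) - gamma k * opnorm (U k)|) &
          forall x, summable_seq (fun k =>
            `|inv_op (U k) x - inv_op (U k.+1) x|)] &
          0 < lambda0 /\ forall k, lambda0 <= lambda k]))
  (x0 : H) (x y : nat -> H) (x_init : x 0%N = x0)
  (y_def : forall k,
     y k = x k - gamma k *: U k (gradient ip f (x k) + b k))
  (x_step : forall k,
     x k.+1 = x k + lambda k *: (inv_proj ip (U k) C (y k) + a k - x k)) :
  [/\ forall xs, Omega xs -> cvgn (fun k => inv_norm ip (U k) (x k - xs)),
      `|x k - inv_proj ip (U k) C (x k - gamma k *: U k (gradient ip f (x k)))|
        @[k --> \oo] --> (0 : R),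
      exists2 xbar, Omega xbar & weak_cvg ip x xbar &
      forall xs, Omega xs ->
        gradient ip f (x k) @[k --> \oo] --> gradient ip f xs].
Proof.
have inverse k : exists W : {linear H -> H},
    inv_op (U k) = W /\ forall h, U k (W h) = h.
  by have [W WE WU] := calP_inverse ip_norm alpha_gt0 (U_calP k); exists W.
have [W0 W0P] := choice inverse.
have invE k : inv_op (U k) = W0 k := (W0P k).1.
have UW k h : U k (W0 k h) = h := (W0P k).2 h.
have U_gt0 k : 0 < opnorm (U k).
  have /andP[g0 g1] := gamma_bounds k; have := lt_trans g0 g1.
  by rewrite pmulr_rgt0 ?invr_gt0// mulr_gt0// /beta invr_gt0.
have U_le k : opnorm (U k) <= mu by apply: ub_le_sup => //; exists k.
have mu_gt0 : 0 < mu := lt_le_trans (U_gt0 0%N) (U_le 0%N).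
have gamma_gt0 k : 0 < gamma k by have /andP[] := gamma_bounds k.
pose theta k := gamma k * opnorm (U k) * L / 2.
have thetaP k : theta k < 1 /\ 1 / alpha_ k = 2 - theta k.
  have /andP[g0 g1] := gamma_bounds k.
  exact: (relaxation_bound L_gt0 g1 (U_gt0 k)).
have theta_lt1 k : theta k < 1 := (thetaP k).1.
have alphaE k : 1 / alpha_ k = 2 - theta k := (thetaP k).2.
have lambdaP k : 0 < lambda k < 2 - theta k.
  by rewrite -alphaE; exact: lambda_bounds.
have x_step' k : x k.+1 = x k + lambda k *: (inv_proj ip (U k) C
    (x k - gamma k *: U k (gradient ip f (x k) + b k)) + a k - x k).
  by rewrite x_step y_def.
have [xs0 xs0O] := Omega_nonempty.
have [lam0 [gam0 [l0 lamP g0 [gamP z0]]]] : exists lam0 gam0 : R,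
  [/\ 0 < lam0, forall k, lam0 <= lambda k, 0 < gam0 &
  (forall k, gam0 <= gamma k) /\
  (x k - inv_proj ip (U k) C (x k - gamma k *: U k (gradient ip f (x k))))
    @[k --> \oo] --> (0 : H)].
  case: AB => [[lam0 [tau [gam0 [eps [l0 lP tP [g0 gP eP]]]]]] |
    [lam0 [gam0 [eps [_ [g0 gP eP] [dg dt dW] [l0 lP]]]]]].
  - exists lam0, gam0; split => //.
      by move=> k; have /andP[] := lP k.
    split; first by move=> k; have /andP[] := gP k.
    have /andP[t0 _] := tP 0%N.
    apply: (residual_cvg0_relaxed ip_norm C_nonempty C_closed C_convex
      f_convex f_diff L_gt0 f_lip alpha_gt0 eta_ge0 eta_summable U_calP
      U_monotone invE UW U_gt0 U_le gamma_gt0 theta_lt1 lambdaP a_summable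
      b_summable x_step' xs0O (mulr_gt0 l0 t0)) => k.
    have /andP[h1 h2] := lP k; rewrite alphaE in h2.
    apply: ler_pM => //; [exact: ltW | exact: ltW |].
    by rewrite /theta in h2; lra.
  - exists lam0, gam0; split => //; split; first by move=> k; have /andP[] := gP k.
    have /andP[e0 _] := eP.
    have e1 : 0 < eps * L / 2 by rewrite divr_gt0// mulr_gt0.
    apply: (residual_cvg0_slow ip_norm C_nonempty C_closed C_convex
      f_convex f_diff L_gt0 f_lip alpha_gt0 eta_ge0 eta_summable U_calP
      U_monotone invE UW U_gt0 U_le gamma_gt0 theta_lt1 lambdaP a_summable
      b_summable x_step' xs0O l0 lP g0 _ e1).
    + by move=> k; have /andP[] := gP k.
    + move=> k; have /andP[_ h] := gP k.
      exact: (theta_bound L_gt0 (U_le k) mu_gt0 (gamma_gt0 k) h).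
    + by apply: (cvg_norm_le0 _ (summable_cvg0 dg)) => k.
    + apply: (cvg_norm_le0 _ (summable_cvg0 (summableZ (c := L / 2) dt))) => k.
      have -> : theta k.+1 - theta k = (L / 2) *
        (gamma k.+1 * opnorm (U k.+1) - gamma k * opnorm (U k)).
        by rewrite /theta; ring.
      by rewrite normrM gtr0_norm// divr_gt0.
    + move=> v M vM.
      apply: (strongly_summable_cvg0 ip_norm
        (D := fun k h => W0 k h - W0 k.+1 h) _ _ vM).
        move=> k h1 h2; rewrite ipBl ipBr.
        by rewrite (inverse_self_adjoint (U_calP k) (UW k))
          (inverse_self_adjoint (U_calP k.+1) (UW k.+1)).
      move=> h; have := dW h; congr (summable_seq _); apply/funext => k.
      by rewrite !invE.
have Bcvg xs : Omega xs ->
    gradient ip f (x k) @[k --> \oo] --> gradient ip f xs.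
  move=> xsO; exact: (gradient_cvg ip_norm C_nonempty C_closed C_convex
    f_convex f_diff L_gt0 f_lip alpha_gt0 eta_ge0 eta_summable U_calP
    U_monotone invE UW U_gt0 gamma_gt0 theta_lt1 lambdaP a_summable
    b_summable x_step' xsO l0 lamP g0 gamP z0).
split.
- move=> xs xsO.
  have [xi_cvg _] := fejer ip_norm C_nonempty C_closed C_convex
    f_convex f_diff L_gt0 f_lip alpha_gt0 eta_ge0 eta_summable U_calP
    U_monotone invE UW U_gt0 gamma_gt0 theta_lt1 lambdaP a_summable
    b_summable x_step' xsO.
  have -> : (fun k => inv_norm ip (U k) (x k - xs)) =
      (fun k => Num.sqrt (ip (W0 k (x k - xs)) (x k - xs))).
    by apply/funext => k; rewrite /inv_norm invE.
  apply/cvg_ex; eexists; apply: continuous_cvg xi_cvg.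
  exact: sqrt_continuous.
- by rewrite -(normr0 H); apply: cvg_norm.
- exact: (weak_convergence ip_norm C_nonempty C_closed C_convex
    f_convex f_diff L_gt0 f_lip alpha_gt0 eta_ge0 eta_summable U_calP
    U_monotone invE UW U_gt0 U_le gamma_gt0 theta_lt1 lambdaP a_summable
    b_summable x_step' xs0O g0 gamP z0 (Bcvg _ xs0O)).
- exact: Bcvg.
Qed.
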